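(* Let $\mu$ be a sigma-finite Borel measure on $\mathbb{R}$ without atoms, let $U\subset\mathbb{R}$ be a Borel subset with $\mu(\mathbb{R}\setminus U)=0$, and let $H$ be a reproducing kernel subspace in $L^2(\mathbb{R},\mu)$ (of functions on $U$) that separates zeros and such that for any $k\in U$ one has the implication $$f\in H,\ f(k)=0\ \Longrightarrow\ \frac{f}{x-k}\in H.$$ Then for any $p\in U$ the following holds. (1) The set of accumulation points of zeros of the function $K_p$ is contained in $\partial U\cup\{\infty\}$. (2) There exists an open neighbourhood $V_p\subset\mathbb{C}$ of $p$ such that for any $f\in H$ the function $f/K_p$ extends to an analytic function in $V_p$. (3) There exists a discrete subset $\mathcal{N}_p\subset\mathbb{R}\setminus\partial U$ such that for any $f\in H$ the function $f/K_p$ extends to a meromorphic function in $\mathbb{C}\setminus\partial U$ all of whose poles are contained in $\mathcal{N}_p$.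
   Context: Functions are complex-valued. A linear set $H$ of Borel functions $f$ on $U$ (actual functions, not equivalence classes) satisfying $\int|f|^2\,d\mu<\infty$ is called a reproducing kernel subspace in $L^2(\mathbb{R},\mu)$ if it is closed in the $L^2(\mathbb{R},\mu)$ norm and, for every $k\in U$, the functional $f\mapsto f(k)$ on $H$ is bounded in the $L^2(\mathbb{R},\mu)$ norm. For $w\in U$, the reproducing kernel at $w$ is the element $K_w=K(\cdot,w)\in H$ with $f(w)=\langle f,K_w\rangle$ for all $f\in H$, where $\langle f,g\rangle=\int f\overline{g}\,d\mu$. $H$ separates zeros if for any $p\in U$ there exists $f_p\in H$ with $f_p(p)\neq0$. An expression of the form $g/(x-p)\in H$ means that there is a (unique) function $h\in H$ such that $h(x)(x-p)=g(x)$ for all $x\in U$. $\partial U$ is the boundary of $U$ as a subset of $\mathbb{R}$. Zeros of $K_p$ are its zeros in $U$. The function $f/K_p$ is defined on $\{x\in U: K_p(x)\neq0\}$, and an extension to an open set $G\subset\mathbb{C}$ is a function agreeing with $f/K_p$ at the points of this set lying in $G$ (for a meromorphic extension, outside its poles). A discrete subset of $\mathbb{R}\setminus\partial U$ is one with no accumulation points in $\mathbb{R}\setminus\partial U$. *)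

(* Defs.v *)
From HB Require Import structures.
From mathcomp Require Import all_boot all_order all_algebra.
From mathcomp Require Import complex.
From mathcomp Require Import all_classical all_reals all_analysis.

Set Implicit Arguments.
Unset Strict Implicit.
Unset Printing Implicit Defensive.

Import Order.TTheory GRing.Theory Num.Theory.
Import numFieldTopology.Exports numFieldNormedType.Exports.

Local Open Scope classical_set_scope.
Local Open Scope ring_scope.
Local Open Scope complex_scope.

(* [cplx R] is the field R[i] seen as a normed space over itself, so that
   [derivable F z 1] for F : cplx R -> cplx R is complex differentiability. *)
Notation cplx R := (R[i]^o).

(* |z| as an element of R; the library's `|z| lives in R[i]. *)
Definition cabs {R : realType} (z : R[i]) : R := Normc.normc z.

(* A function on U is a function on the subtype of points of U; it is
   extended by 0 off U when it has to be measured or integrated on R. *)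
Definition zext {R : realType} (U : set R) (f : U -> R[i]) : R -> R[i] :=
  valL_ 0 f.

Definition borelC {R : realType} (U : set R) (f : U -> R[i]) : Prop :=
  measurable_fun (U : set (measurableTypeR R))
    (zext f : measurableTypeR R -> g_sigma_algebraType (@open (cplx R))).

Section L2.
Context {R : realType} (mu : {measure set (measurableTypeR R) -> \bar R}).
Context (U : set R).

Definition sqint (f : U -> R[i]) : \bar R :=
  (\int[mu]_(x in U) ((cabs (zext f x) ^+ 2)%:E))%E.

Definition L2 (f : U -> R[i]) : Prop := borelC f /\ (sqint f < +oo)%E.

Definition L2norm (f : U -> R[i]) : R := Num.sqrt (fine (sqint f)).

Definition Cintegral (f : R -> R[i]) : R[i] :=
  (\int[mu]_(x in U) complex.Re (f x)) +i* (\int[mu]_(x in U) complex.Im (f x)).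

Definition L2inner (f g : U -> R[i]) : R[i] :=
  Cintegral (fun x => zext f x * (zext g x)^*).

Definition linear_set (H : set (U -> R[i])) : Prop :=
  [/\ H (fun=> 0),
      forall f g, H f -> H g -> H (fun x => f x + g x) &
      forall (c : R[i]) f, H f -> H (fun x => c * f x)].

(* H consists of functions, the L^2 norm only sees almost everywhere classes:
   an L^2 function in the closure of H agrees almost everywhere with
   an element of H. *)
Definition L2closed (H : set (U -> R[i])) : Prop :=
  forall f, L2 f ->
    (forall e : R, 0 < e ->
       exists2 h, H h & L2norm (fun x => f x - h x) < e) ->
    exists2 g, H g & ae_eq mu U (zext f) (zext g).

Definition bounded_evaluation (H : set (U -> R[i])) (k : U) : Prop :=
  exists M : R, forall f, H f -> cabs (f k) <= M * L2norm f.

Definition repr_kernel_subspace (H : set (U -> R[i])) : Prop :=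
  [/\ linear_set H, H `<=` L2, L2closed H &
      forall k : U, bounded_evaluation H k].

Definition is_repr_kernel (H : set (U -> R[i])) (w : U) (K : U -> R[i]) :=
  H K /\ forall f, H f -> f w = L2inner f K.

(* For a reproducing kernel subspace H exactly one K satisfies
   [is_repr_kernel H w K], by the Riesz representation theorem; the default
   value of [xget] is then irrelevant. *)
Definition repr_kernel (H : set (U -> R[i])) (w : U) : U -> R[i] :=
  xget (fun=> 0) [set K | is_repr_kernel H w K].

Definition separates_zeros (H : set (U -> R[i])) : Prop :=
  forall p : U, exists2 f, H f & f p != 0.

(* g / (x - p) \in H. The witness h is unique when mu has no atoms and H is
   a reproducing kernel subspace: two witnesses differ at most at p, hence
   agree almost everywhere, and evaluation at p is bounded. *)
Definition quotient_in (H : set (U -> R[i])) (g : U -> R[i]) (p : U) : Prop :=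
  exists2 h, H h & forall x : U, h x * (val x - val p)%:C = g x.

Definition zeros (f : U -> R[i]) : set R :=
  [set x | exists2 u : U, val u = x & f u = 0].
End L2.

Definition boundary {T : topologicalType} (A : set T) : set T :=
  closure A `\` interior A.

Definition realset {R : realType} (A : set R) : set (cplx R) :=
  [set x%:C | x in A].

Section ComplexFunctions.
Context {R : realType}.

Definition analytic_on (G : set (cplx R)) (F : cplx R -> cplx R) : Prop :=
  forall z, G z -> derivable F z 1.

Definition analytic_at (F : cplx R -> cplx R) (a : cplx R) : Prop :=
  \forall z \near a, derivable F z 1.

Definition is_pole (F : cplx R -> cplx R) (a : cplx R) : Prop :=
  (\forall z \near a^', derivable F z 1) /\ cabs (F z) @[z --> a^'] --> +oo.

(* The value of F at a pole is arbitrary. *)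
Definition meromorphic_on (G : set (cplx R)) (F : cplx R -> cplx R) : Prop :=
  forall a, G a -> analytic_at F a \/ is_pole F a.

Definition poles_in (G : set (cplx R)) (F : cplx R -> cplx R) :
  set (cplx R) := [set a | G a /\ is_pole F a].

(* F agrees with f / g at the points of D lying in the domain
   {x in U | g x <> 0} of that quotient. *)
Definition extends_quotient (U : set R) (f g : U -> R[i])
    (D : set (cplx R)) (F : cplx R -> cplx R) : Prop :=
  forall x : U, g x != 0 -> D (val x)%:C -> F (val x)%:C = f x / g x.
End ComplexFunctions.

(* Main.v *)
(* Call [ran l] the set of products [(X - l) g] lying in H with g in H.  For k in
   U this is the set of f in H vanishing at k, and division by [X - k] is bounded
   there.  Hence near [l = p] every f in H is uniquely [c(l) K_p + (X - l) g(l)],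
   with c analytic by a Neumann series; evaluating at [l] in U gives
   c(l) = f(l) / K_p(l).  Regularity, meaning that [X - l] is bounded below with
   range of codimension one, spreads from p to all non-real l, and from there to
   the real points outside the closure of U.  At a regular l with
   [K_p = (X - l) g], symmetry of the multiplication by X forces l to be real and
   g not to be in [ran l]; decomposing along g instead of K_p near such a point
   shows that it is isolated, and at worst a simple pole of c. *)
Require Import Defs.
From HB Require Import structures.
From mathcomp Require Import all_boot all_order all_algebra.
From mathcomp Require Import complex ring lra.
From mathcomp Require Import all_classical all_reals all_analysis.
From mathcomp Require Import measurable_realfun.
Import Order.TTheory GRing.Theory Num.Theory.
Import numFieldTopology.Exports numFieldNormedType.Exports.
Set Implicit Arguments.
Unset Strict Implicit.
Unset Printing Implicit Defensive.
Local Open Scope classical_set_scope.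
Local Open Scope ring_scope.
Local Open Scope complex_scope.

(** Multiplication by X is only partially defined on H, and its domain need not be dense: for
    suitable [mu], H may consist of the polynomials of degree less than n. Hence no adjoint or
    resolvent is used; everything goes through the relation [mulX] and the decompositions f = c e +
    (X - l) g. Two kinds of points pose opposite difficulties. At a point k of U the range of X - k
    is known, but |x - k| has no positive lower bound on U in general, so the boundedness of
    division must come from symmetry and the uniform boundedness principle. Away from U a lower
    bound is read off pointwise, but the codimension of the range is not known there and has to be
    transported from p through overlapping discs. Analyticity of c comes from a second-order
    estimate: decomposing g, and then its own quotient, leaves a remainder of order (l - l0)^2. The
    measure enters only through the fields of [division_space]. *)

(** * The modulus of a complex number as a real number *)

Section Cabs.
Context {R : realType}.
Implicit Types z w : R[i].

Lemma cabsE z : `|z| = (cabs z)%:C.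
Proof. by rewrite normc_def; case: z. Qed.

Lemma cabs_ge0 z : 0 <= cabs z.
Proof. by case: z => a b; rewrite /cabs /= sqrtr_ge0. Qed.

Lemma cabs0 : cabs (0 : R[i]) = 0.
Proof. exact: Normc.normc0. Qed.

Lemma cabs1 : cabs (1 : R[i]) = 1.
Proof. exact: Normc.normc1. Qed.

Lemma cabs_eq0 z : cabs z = 0 -> z = 0.
Proof. exact: Normc.eq0_normc. Qed.

Lemma cabs_gt0 z : z != 0 -> 0 < cabs z.
Proof.
by move=> z0; rewrite lt_def cabs_ge0 andbT; apply: contra z0 => /eqP/cabs_eq0 ->.
Qed.

Lemma cabsM z w : cabs (z * w) = cabs z * cabs w.
Proof. exact: Normc.normcM. Qed.

Lemma cabsV z : cabs z^-1 = (cabs z)^-1.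
Proof. exact: Normc.normcV. Qed.

Lemma cabsD z w : cabs (z + w) <= cabs z + cabs w.
Proof. by rewrite -lecR rmorphD/= -!cabsE ler_normD. Qed.

Lemma cabsN z : cabs (- z) = cabs z.
Proof. by apply: complexI; rewrite -!cabsE normrN. Qed.

Lemma cabsB z w : cabs (z - w) = cabs (w - z).
Proof. by rewrite -cabsN opprB. Qed.

Lemma cabs_real (x : R) : cabs x%:C = `|x|.
Proof. by rewrite /cabs /= expr0n /= addr0 sqrtr_sqr. Qed.

Lemma cabsJ z : cabs z^*%C = cabs z.
Proof. by apply: complexI; rewrite -!cabsE normcJ. Qed.

Lemma sqr_cabs z : cabs z ^+ 2 = complex.Re z ^+ 2 + complex.Im z ^+ 2.
Proof. by case: z => a b; rewrite /cabs /= sqr_sqrtr// addr_ge0// sqr_ge0. Qed.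

(* Inside a product the notation [^*] is [Num.conj], as in [L2inner]. *)
Lemma conjCE z : Num.conj z = z^*%C.
Proof. by []. Qed.

Lemma conjcM z w : (z * w)^*%C = z^*%C * w^*%C.
Proof. exact: rmorphM. Qed.

Lemma conjcN z : (- z)^*%C = - z^*%C.
Proof. exact: rmorphN. Qed.

Lemma mul_conjc z : z * z^*%C = (cabs z ^+ 2)%:C.
Proof. by rewrite -sqr_normc cabsE rmorphXn. Qed.

Lemma Re_le_cabs z : `|complex.Re z| <= cabs z.
Proof. by rewrite -lecR -cabsE normc_ge_Re. Qed.

Lemma Im_le_cabs z : `|complex.Im z| <= cabs z.
Proof.
rewrite -(ler_pXn2r (n := 2)) ?nnegrE ?cabs_ge0// real_normK ?num_real//.
by rewrite sqr_cabs lerDr sqr_ge0.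
Qed.

Lemma cabs_le_ReIm z : cabs z <= `|complex.Re z| + `|complex.Im z|.
Proof.
rewrite -(ler_pXn2r (n := 2)) ?nnegrE ?addr_ge0 ?cabs_ge0// sqr_cabs sqrrD.
rewrite !real_normK ?num_real// -addrA lerD2l -[leLHS]add0r lerD2r.
by rewrite mulrn_wge0// mulr_ge0.
Qed.

End Cabs.

(** * Complex inner product spaces and their completeness *)

Record prehilbert {R : realType} {V : lmodType R[i]}
    (ip : V -> V -> R[i]) (N : V -> R) : Prop := Prehilbert {
  ipDl : forall f g h, ip (f + g) h = ip f h + ip g h;
  ipZl : forall c f g, ip (c *: f) g = c * ip f g;
  ipC : forall f g, ip g f = (ip f g)^*%C;
  ipff : forall f, ip f f = (N f ^+ 2)%:C;
  N_ge0 : forall f, 0 <= N f;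
  N_eq0 : forall f, N f = 0 -> f = 0 }.

(** Completeness is required only along geometric steps, with an explicit rate: the minimising
    sequence, the gliding hump and the Neumann iteration all have this form, and each uses the
    rate. *)
Record hilbert {R : realType} {V : lmodType R[i]}
    (ip : V -> V -> R[i]) (N : V -> R) : Prop := Hilbert {
  hilbert_prehilbert :> prehilbert ip N;
  hilbert_complete : forall (u : nat -> V) (M q : R), 0 <= q -> q < 1 ->
    (forall n, N (u n.+1 - u n) <= M * q ^+ n) ->
    exists l, forall n, N (l - u n) <= M * q ^+ n / (1 - q) }.

Section Prehilbert.
Context {R : realType} {V : lmodType R[i]} (ip : V -> V -> R[i]) (N : V -> R).
Hypothesis hV : prehilbert ip N.
Implicit Types (f g h : V) (c : R[i]).

Lemma ip0l f : ip 0 f = 0.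
Proof. by rewrite -(scale0r (0 : V)) (ipZl hV) mul0r. Qed.

Lemma ip0r f : ip f 0 = 0.
Proof. by rewrite (ipC hV) ip0l conjc0. Qed.

Lemma ipNl f g : ip (- f) g = - ip f g.
Proof. by rewrite -scaleN1r (ipZl hV) mulN1r. Qed.

Lemma ipBl f g h : ip (f - g) h = ip f h - ip g h.
Proof. by rewrite (ipDl hV) ipNl. Qed.

Lemma ipDr f g h : ip f (g + h) = ip f g + ip f h.
Proof. by rewrite (ipC hV) (ipDl hV) rmorphD/= -!(ipC hV). Qed.

Lemma ipZr c f g : ip f (c *: g) = c^*%C * ip f g.
Proof. by rewrite (ipC hV) (ipZl hV) rmorphM/= -(ipC hV). Qed.

Lemma ipNr f g : ip f (- g) = - ip f g.
Proof. by rewrite (ipC hV) ipNl rmorphN/= -(ipC hV). Qed.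

Lemma ipBr f g h : ip f (g - h) = ip f g - ip f h.
Proof. by rewrite ipDr ipNr. Qed.

Lemma N0 : N 0 = 0.
Proof.
have := ipff hV 0; rewrite ip0l => /esym/eqP; rewrite -(rmorph0 (real_complex R)).
by move=> /eqP/complexI/eqP; rewrite sqrf_eq0 => /eqP.
Qed.

Lemma N_scale c f : N (c *: f) = cabs c * N f.
Proof.
apply/eqP; rewrite -(eqrXn2 (n := 2)) ?mulr_ge0 ?cabs_ge0 ?(N_ge0 hV)//.
apply/eqP; apply: complexI; rewrite -(ipff hV) ipZr (ipZl hV) (ipff hV).
by rewrite mulrA [_^*%C * _]mulrC mul_conjc -rmorphM exprMn.
Qed.

Lemma N_opp f : N (- f) = N f.
Proof. by rewrite -scaleN1r N_scale cabsN cabs1 mul1r. Qed.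

Lemma N_distC f g : N (f - g) = N (g - f).
Proof. by rewrite -N_opp opprB. Qed.

Lemma sqr_N f : N f ^+ 2 = complex.Re (ip f f).
Proof. by rewrite (ipff hV). Qed.

Lemma sqr_ND f g :
  N (f + g) ^+ 2 = N f ^+ 2 + N g ^+ 2 + 2 * complex.Re (ip f g).
Proof.
rewrite !sqr_N (ipDl hV) !ipDr [ip g f](ipC hV).
case: (ip f g) (ip f f) (ip g g) => a b [a1 b1] [a2 b2] /=; ring.
Qed.

Lemma cauchy_schwarz f g : cabs (ip f g) <= N f * N g.
Proof.
have [->|g0] := eqVneq g 0; first by rewrite ip0r cabs0 mulr_ge0 ?(N_ge0 hV).
have Ng : 0 < N g.
  by rewrite lt_def (N_ge0 hV) andbT; apply: contra g0 => /eqP/(N_eq0 hV) ->.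
(* This vector is [N g ^+ 2] times the component of f orthogonal to g. *)
have := sqr_ge0 (N ((N g ^+ 2)%:C *: f + (- ip f g) *: g)).
rewrite sqr_ND !N_scale (ipZl hV) ipZr cabsN cabs_real ger0_norm ?sqr_ge0//.
rewrite rmorphN mulNr [_^*%C * _]mulrC mul_conjc -rmorphN -rmorphM.
rewrite [complex.Re _]/=.
set a := cabs _; set b := N f; set c := N g in Ng * => h.
have {}h : 0 <= c ^+ 2 * ((b * c) ^+ 2 - a ^+ 2) by move: h; congr (_ <= _); ring.
rewrite pmulr_rge0 ?exprn_gt0// subr_ge0 in h.
by rewrite -(ler_pXn2r (n := 2)) ?nnegrE ?mulr_ge0 ?cabs_ge0 ?(N_ge0 hV).
Qed.

Lemma N_triangle f g : N (f + g) <= N f + N g.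
Proof.
rewrite -(ler_pXn2r (n := 2)) ?nnegrE ?addr_ge0 ?(N_ge0 hV)// sqr_ND sqrrD.
have := le_trans (ler_norm _) (Re_le_cabs (ip f g)).
have := cauchy_schwarz f g; lra.
Qed.

Lemma geometric_le0 (x M q : R) : 0 <= q -> q < 1 ->
  (forall n, x <= M * q ^+ n) -> x <= 0.
Proof.
move=> q0 q1 hx; apply/ler_addgt0Pr => e e0; rewrite add0r.
have : (fun n => M * q ^+ n) @ \oo --> (M * 0 : R).
  by apply: cvgM; [exact: cvg_cst | apply: cvg_expr; rewrite ger0_norm].
rewrite mulr0 => /cvgrPdist_lt/(_ e e0) [n _ /(_ n (leqnn n))] /=.
by rewrite sub0r normrN => /ltW; apply: le_trans; rewrite (le_trans (hx n)) ?ler_norm.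
Qed.

Lemma N_geometric_eq0 f (M q : R) : 0 <= q -> q < 1 ->
  (forall n, N f <= M * q ^+ n) -> f = 0.
Proof.
move=> q0 q1 hf; apply: (N_eq0 hV); apply/eqP; rewrite eq_le (N_ge0 hV) andbT.
exact: geometric_le0 hf.
Qed.

Lemma N_geometric_cauchy (u : nat -> V) (M q : R) : 0 <= q -> q < 1 ->
  (forall n, N (u n.+1 - u n) <= M * q ^+ n) ->
  forall n m, (n <= m)%N -> N (u m - u n) <= M * q ^+ n / (1 - q).
Proof.
move=> q0 q1 hu n m /subnKC <-; move: (m - n)%N => {}m.
have p0 : 0 < 1 - q by rewrite subr_gt0.
have M0 : 0 <= M by have := hu 0%N; rewrite mulr1; apply: le_trans; exact: (N_ge0 hV).
(* The induction on m needs the exact geometric sum; its factor 1 - q ^+ m is at most 1 and is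
   dropped at the end. *)
rewrite ler_pdivlMr//; apply: (@le_trans _ _ (M * q ^+ n * (1 - q ^+ m))); last first.
  by rewrite ler_piMr ?mulr_ge0 ?exprn_ge0// lerBlDr lerDl exprn_ge0.
elim: m => [|m IH]; first by rewrite addn0 subrr N0 mul0r subrr mulr0.
have -> : u (n + m.+1)%N - u n = (u (n + m).+1 - u (n + m)%N) + (u (n + m)%N - u n).
  by rewrite addnS addrA subrK.
have h := ler_wpM2r (ltW p0) (hu (n + m)%N).
have := ler_wpM2r (ltW p0) (N_triangle (u (n + m).+1 - u (n + m)%N) (u (n + m)%N - u n)).
rewrite [q ^+ m.+1]exprS; move: h; rewrite exprD; move: IH; lra.
Qed.

End Prehilbert.

(** * Riesz representation and uniform boundedness *)

Section Hilbert.
Context {R : realType} {V : lmodType R[i]} (ip : V -> V -> R[i]) (N : V -> R).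
Hypothesis hV : hilbert ip N.
Implicit Types (f g h : V) (c : R[i]).

Section Riesz.
Variable phi : V -> R[i].
Hypothesis phiD : forall f g, phi (f + g) = phi f + phi g.
Hypothesis phiZ : forall c f, phi (c *: f) = c * phi f.
Variable M : R.
Hypothesis phiM : forall f, cabs (phi f) <= M * N f.

Let phiN f : phi (- f) = - phi f.
Proof. by rewrite -scaleN1r phiZ mulN1r. Qed.

Let minimal_vector : (exists f, phi f != 0) ->
  exists2 l, phi l = 1 & forall f, phi f = 1 -> N l ^+ 2 <= N f ^+ 2.
Proof.
move=> [f0 f00].
pose S := [set N f ^+ 2 | f in [set f | phi f = 1]].
have S0 : S !=set0.
  exists (N ((phi f0)^-1 *: f0) ^+ 2); exists ((phi f0)^-1 *: f0) => //=.
  by rewrite phiZ mulVf.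
have lbS : lbound S 0 by move=> _ [f _ <-]; exact: sqr_ge0.
have infS : has_inf S by split=> //; exists 0.
pose d := inf S.
have dP f : phi f = 1 -> d <= N f ^+ 2.
  by move=> f1; apply: ge_inf; [exists 0 | exists f].
have d0 : 0 <= d by apply: lb_le_inf.
have : forall n, exists f, phi f = 1 /\ N f ^+ 2 <= d + (2^-1 ^+ n) ^+ 2.
  move=> n; have e0 : 0 < ((2^-1 : R) ^+ n) ^+ 2 by rewrite !exprn_gt0// invr_gt0.
  have [_ [f f1 <-] /ltW h] := inf_adherent e0 infS.
  by exists f; split.
move=> /choice[u uP].
have u1 n : phi (u n) = 1 by have [] := uP n.
have ud n : N (u n) ^+ 2 <= d + (2^-1 ^+ n) ^+ 2 by have [] := uP n.
have q0 : 0 <= 2^-1 :> R by rewrite invr_ge0.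
have q1 : 2^-1 < 1 :> R by rewrite invf_lt1// ltr1n.
have y0 n : 0 <= 2^-1 ^+ n :> R by rewrite exprn_ge0.
have y1 n : 2^-1 ^+ n <= 1 :> R by rewrite exprn_ile1// ltW.
have step n : N (u n.+1 - u n) <= 2 * 2^-1 ^+ n.
  rewrite -(ler_pXn2r (n := 2)) ?nnegrE ?(N_ge0 hV) ?mulr_ge0//.
  rewrite (sqr_ND hV) (N_opp hV) (ipNr hV).
  (* The midpoint also satisfies phi = 1, so its squared norm is at least d, and the parallelogram
     law bounds the difference. The tolerance was squared in order to make this bound geometric in
     n. *)
  have := dP (2^-1 *: (u n.+1 + u n)); rewrite phiZ phiD !u1.
  have -> : 2^-1 * (1 + 1) = 1 :> R[i] by rewrite -(natrD _ 1 1) mulVf.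
  move=> /(_ erefl); rewrite (N_scale hV) exprMn.
  have -> : cabs (2^-1 : R[i]) = 2^-1.
    have -> : 2^-1 = (2^-1)%:C :> R[i] by rewrite fmorphV rmorphD rmorph1.
    by rewrite cabs_real ger0_norm.
  rewrite (sqr_ND hV); have := ud n; have := ud n.+1.
  have := y0 n; rewrite [2^-1 ^+ n.+1]exprS.
  set y := _ ^+ n; case: (ip _ _) => a b /=; have := sqr_ge0 y; lra.
have [l lP] := hilbert_complete hV q0 q1 step.
have {}lP n : N (l - u n) <= 4 * 2^-1 ^+ n.
  by have := lP n; rewrite [1 - _](_ : _ = 2^-1) ?invrK; lra.
exists l.
  apply/eqP; rewrite -subr_eq0; apply/eqP/cabs_eq0/eqP.
  rewrite eq_le cabs_ge0 andbT.
  have [M0|M0] := leP M 0.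
    rewrite -(u1 0) -phiN -phiD (le_trans (phiM _))//.
    by rewrite mulr_le0_ge0// (N_ge0 hV).
  apply: (@geometric_le0 _ _ (M * 4) (2^-1)) => // n.
  rewrite -(u1 n) -phiN -phiD (le_trans (phiM _))//.
  by rewrite -mulrA ler_pM2l// lP.
move=> f /dP; apply: le_trans.
rewrite -subr_le0.
(* Let y = 2^-n, and let a and b be the norms of u n and l - u n. Then a ^+ 2 <= d + y, b ^+ 2 <= 16
   y and 2 a b <= 8 (d + 2) y. *)
apply: (@geometric_le0 _ _ (17 + 8 * (d + 2)) (2^-1)) => // n.
have -> : l = u n + (l - u n) by rewrite addrC subrK.
rewrite (sqr_ND hV).
have := le_trans (ler_norm _) (Re_le_cabs (ip (u n) (l - u n))).
move=> /le_trans /(_ (cauchy_schwarz hV _ _)).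
have := lP n; have := ud n; have := y0 n; have := y1 n.
have := N_ge0 hV (u n); have := N_ge0 hV (l - u n).
move: (N (u n)) (N (l - u n)) (2^-1 ^+ n) (complex.Re _) => a b y r.
move=> b0 a0 yl1 yg0 ua by4 rab.
have a2 : a <= d + 2 by nra.
have : b ^+ 2 <= 16 * y by nra.
have : a * b <= (d + 2) * (4 * y) by rewrite ler_pM.
have : y ^+ 2 <= y by nra.
lra.
Qed.

(** A vector of least norm on the hyperplane phi = 1 is orthogonal to the kernel of phi, so a
    multiple of it represents phi. *)
Lemma riesz : exists e, forall f, phi f = ip f e.
Proof.
have [/minimal_vector[l l1 lmin]|phi0] := pselect (exists f, phi f != 0); last first.
  exists 0 => f; rewrite (ip0r hV); apply/eqP; apply: contrapT => /negP h.
  by apply: phi0; exists f.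
have orth h : phi h = 0 -> ip h l = 0.
  move=> h0; apply/cabs_eq0/eqP; rewrite eq_le cabs_ge0 andbT.
  (* With a = |<h, l>|, the perturbation of l below changes its squared norm by s a ^+ 2 (s N h ^+ 2
     - 2). The + 1 keeps s N h ^+ 2 below 1 and covers h = 0. *)
  pose s := (N h ^+ 2 + 1)^-1.
  have k0 : 0 < N h ^+ 2 + 1 by rewrite ltr_wpDl ?sqr_ge0.
  have s0 : 0 < s by rewrite invr_gt0.
  have sk : s * (N h ^+ 2 + 1) = 1 by rewrite mulVf ?gt_eqF.
  have := lmin (l + (- s%:C * (ip h l)^*%C) *: h).
  rewrite phiD phiZ l1 h0 mulr0 addr0 => /(_ erefl).
  rewrite (sqr_ND hV) (N_scale hV) cabsM cabsN cabs_real cabsJ (gtr0_norm s0).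
  rewrite (ipZr hV) [ip l h](ipC hV) conjcM conjcK conjcN conjc_real.
  rewrite -[_ * _ * _^*%C]mulrA mul_conjc -rmorphN -rmorphM [complex.Re _]/=.
  move: (cabs_ge0 (ip h l)); set a := cabs _ => a0; move: sk k0.
  set k := N h => sk k0 hl.
  rewrite leNgt; apply/negP => ag0.
  have a2 : 0 < a ^+ 2 by rewrite exprn_gt0.
  have {}hl : 0 <= s * a ^+ 2 * (s * k ^+ 2 - 2) by move: hl; lra.
  by move: hl; rewrite pmulr_rge0 ?mulr_gt0//; nra.
have Nl : N l ^+ 2 != 0.
  rewrite expf_neq0//; apply/eqP => /(N_eq0 hV) l0.
  by have := l1; rewrite l0 -(scale0r 0) phiZ mul0r => /eqP; rewrite eq_sym oner_eq0.
exists ((N l ^- 2)%:C *: l) => f.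
have : ip (f - phi f *: l) l = 0.
  by apply: orth; rewrite phiD phiN phiZ l1 mulr1 subrr.
rewrite (ipZr hV) conjc_real (ipBl hV) (ipZl hV) (ipff hV) => /eqP.
rewrite subr_eq0 => /eqP ->.
by rewrite mulrCA -rmorphM mulVf// rmorph1 mulr1.
Qed.

End Riesz.

(* Gliding hump: were [W] unbounded, a sum of small multiples of elements of
   [W] would have unbounded inner products with [W]. *)
Lemma uniform_boundedness (W : set V) :
  (forall f, exists M, forall w, W w -> cabs (ip f w) <= M) ->
  exists M, forall w, W w -> N w <= M.
Proof.
move=> Wf; apply: contrapT => Wunb.
have : forall n, exists w, W w /\ n%:R * 4 ^+ n < N w.
  move=> n; apply: contrapT => h; apply: Wunb; exists (n%:R * 4 ^+ n) => w Ww.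
  by rewrite leNgt; apply/negP => hw; apply: h; exists w.
move=> /choice[w wP].
have Ww n : W (w n) by have [] := wP n.
have wn n : n%:R * 4 ^+ n < N (w n) by have [] := wP n.
have w0 n : 0 < N (w n) by apply: le_lt_trans (wn n); rewrite mulr_ge0// exprn_ge0.
pose q : R := 4^-1.
have q0 : 0 <= q by rewrite invr_ge0.
have q1 : q < 1 by rewrite invf_lt1// ltr1n.
pose v n := (q ^+ n / N (w n))%:C *: w n.
pose good n f := q ^+ n * N (w n) / 2 <= cabs (ip f (w n)).
(* The hump [v m] is added only when the pairing with [w m] is too small. It then contributes q ^+ m
   * N (w m), twice the size asked for, so [good m] holds after the step in either case. *)
pose x := fix x n := if n is m.+1 then
  (if good m (x m) then x m else x m + v m) else 0.
have Nv n : N (v n) = q ^+ n.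
  rewrite (N_scale hV) cabs_real ger0_norm ?divfK ?gt_eqF//.
  by rewrite divr_ge0 ?exprn_ge0// ltW.
have xgood n : good n (x n.+1).
  rewrite /=; have [//|/negP] := boolP (good n (x n)).
  rewrite /good => /negP; rewrite -ltNge (ipDl hV) (ipZl hV) (ipff hV) -rmorphM.
  have -> : q ^+ n / N (w n) * N (w n) ^+ 2 = q ^+ n * N (w n).
    by field; rewrite gt_eqF.
  set b := ip _ _; set a := q ^+ n * _ => hb.
  have := cabsD (b + a%:C) (- b); rewrite cabsN addrAC subrr add0r cabs_real.
  have := ler_norm a; move: hb; lra.
have step n : N (x n.+1 - x n) <= 1 * q ^+ n.
  rewrite /= mul1r; case: ifP => _.
    by rewrite subrr (N0 hV) exprn_ge0.
  by rewrite addrAC subrr add0r Nv.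
have [l lP] := hilbert_complete hV q0 q1 step.
have [M MP] := Wf l.
(* [good] provides 1/2 of q ^+ n * N (w n), the tail of the sum removes at most 1/3 of it, and 1/2 -
   1/3 = 1/6. *)
have [n nM] : exists n, 6 * M < n%:R :> R.
  by exists (Num.truncn (6 * M)).+1; rewrite truncnS_gt.
have := MP _ (Ww n); apply/negP; rewrite -ltNge.
have hg := xgood n; rewrite /good in hg.
have := cabsD (ip l (w n)) (ip (x n.+1 - l) (w n)).
rewrite -(ipDl hV) addrC subrK.
move=> /(le_trans hg).
have := cauchy_schwarz hV (x n.+1 - l) (w n); rewrite (N_distC hV).
have := lP n.+1; rewrite mul1r exprS.
have -> : q * q ^+ n / (1 - q) = q ^+ n / 3 by rewrite /q; field.
have qn : q ^+ n * 4 ^+ n = 1 by rewrite -exprMn mulVf ?expr1n.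
have qn0 : 0 < q ^+ n by rewrite exprn_gt0// invr_gt0.
have := wn n; have := w0 n.
move: (cabs _) (cabs _) (N (_ - _)) (N (w n)) (q ^+ n) (4 ^+ n) qn qn0 => c b a k y z.
move=> yz y0 k0 nk ay bak kcb.
have : a * k <= y / 3 * k by rewrite ler_pM2r.
have : n%:R < y * k.
  have -> : n%:R = y * (n%:R * z) by rewrite mulrCA yz mulr1.
  by rewrite ltr_pM2l.
lra.
Qed.

End Hilbert.

(** * Neighbourhoods and complex derivatives in terms of the real modulus *)

Section ComplexTopology.
Context {R : realType}.
Implicit Types (z w a : cplx R).

Lemma cnbhsP a (P : set (cplx R)) :
  nbhs a P <-> exists2 e : R, 0 < e & forall z, cabs (z - a) < e -> P z.
Proof.
split.
  move=> /nbhs_ballP[e /= e0 eP]; have eR : e = (complex.Re e)%:C.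
    by rewrite RRe_real// gtr0_real.
  exists (complex.Re e) => [|z hz]; first by rewrite -ltcR -eR.
  by apply: eP; rewrite -ball_normE /ball_ /= distrC cabsE eR ltcR.
move=> [e e0 eP]; apply/nbhs_ballP; exists e%:C => /=; first by rewrite ltcR.
move=> z; rewrite -ball_normE /ball_ /= distrC cabsE ltcR; exact: eP.
Qed.

Lemma cdnbhsP a (P : set (cplx R)) : nbhs a^' P <->
  exists2 e : R, 0 < e & forall z, z != a -> cabs (z - a) < e -> P z.
Proof.
rewrite /dnbhs /within /= /nbhs/=; split.
  by move=> /cnbhsP[e e0 eP]; exists e => // z za /eP; apply.
by move=> [e e0 eP]; apply/cnbhsP; exists e => // z /eP h za; apply: h.
Qed.

Lemma derivable_quadratic (F : cplx R -> cplx R) a (L : R[i]) (M e : R) : 0 < e ->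
  (forall z, cabs (z - a) < e ->
    cabs (F z - F a - (z - a) * L) <= M * cabs (z - a) ^+ 2) ->
  derivable F a 1.
Proof.
move=> e0 hF; apply/cvg_ex; exists L; apply/cvgrPdist_lt => _ /posnumP[d].
have dR : d%:num = (complex.Re d%:num)%:C by rewrite RRe_real// gtr0_real.
have d0 : 0 < complex.Re d%:num by rewrite -ltcR -dR; exact: (gt0 d).
set M1 := `|M| + 1.
have M10 : 0 < M1 by rewrite ltr_wpDl.
apply/cdnbhsP; exists (Num.min e (complex.Re d%:num / M1)).
  by rewrite lt_min e0 divr_gt0.
move=> h h0; rewrite subr0 lt_min => /andP[he hd].
rewrite cabsE dR ltcR.
have hza : h *: (1 : cplx R) + a - a = h by rewrite addrK /GRing.scale/= mulr1.
have := hF (h *: (1 : cplx R) + a); rewrite hza => /(_ he).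
set D := F _ - F a => hD.
have -> : L - h^-1 *: D = - (h^-1 * (D - h * L)).
  by rewrite mulrBr mulKf// opprB.
rewrite cabsN cabsM cabsV mulrC ltr_pdivrMr ?cabs_gt0//.
apply: le_lt_trans hD _; rewrite expr2 mulrA ltr_pM2r ?cabs_gt0//.
have := hd; rewrite ltr_pdivlMr// mulrC; apply: le_lt_trans.
rewrite ler_wpM2r ?cabs_ge0//.
by rewrite (le_trans (ler_norm _))// lerDl.
Qed.

Lemma derivable_bounded_near (F : cplx R -> cplx R) a : derivable F a 1 ->
  exists M : R, \forall z \near a, cabs (F z) <= M.
Proof.
move=> /derivable1_diffP/differentiable_continuous.
move=> /cvgrPdist_lt/(_ 1 ltr01)/cnbhsP[e e0 he].
exists (cabs (F a) + 1); apply/cnbhsP; exists e => // z /he.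
rewrite distrC cabsE -[1]/(1%:C) ltcR => /ltW h.
by have := cabsD (F z - F a) (F a); rewrite subrK; lra.
Qed.

End ComplexTopology.

(* [ds_ip_ev] makes multiplication by the real function [X] symmetric. *)
Record division_space {R : realType} {V : lmodType R[i]} (ip : V -> V -> R[i])
    (N : V -> R) {T : Type} (X : T -> R) (ev : V -> T -> R[i]) : Prop := DivisionSpace {
  ds_hilbert : hilbert ip N;
  ds_evD : forall f g x, ev (f + g) x = ev f x + ev g x;
  ds_evZ : forall c f x, ev (c *: f) x = c * ev f x;
  ds_ev_eq0 : forall f, (forall x, ev f x = 0) -> f = 0;
  ds_ev_eq0_off : forall k f, (forall x, x <> k -> ev f x = 0) -> f = 0;
  ds_inj : injective X;
  ds_ev_bounded : forall x, exists M, forall f, cabs (ev f x) <= M * N f;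
  ds_ev_sep : forall x, exists f, ev f x != 0;
  ds_ev_div : forall k f, ev f k = 0 ->
    exists g, forall x, ev f x = ((X x)%:C - (X k)%:C) * ev g x;
  ds_ip_ev : forall f g f' g',
    (forall x, ev f x * (ev g x)^*%C = ev f' x * (ev g' x)^*%C) -> ip f g = ip f' g';
  ds_N_mono : forall (d : R) f g, 0 <= d ->
    (forall x, d * cabs (ev f x) <= cabs (ev g x)) -> d * N f <= N g }.

(** * Decompositions along a vector and their dependence on l *)

Section Division.
Context {R : realType} {V : lmodType R[i]} (ip : V -> V -> R[i]) (N : V -> R).
Context {T : Type} (X : T -> R) (ev : V -> T -> R[i]).
Hypothesis hS : division_space ip N X ev.

Let hV := ds_hilbert hS.
Let evD := ds_evD hS.
Let evZ := ds_evZ hS.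
Let ev_eq0 := ds_ev_eq0 hS.
Let ev_eq0_off := ds_ev_eq0_off hS.
Let X_inj := ds_inj hS.
Let ev_bounded := ds_ev_bounded hS.
Let ev_sep := ds_ev_sep hS.
Let ev_div := ds_ev_div hS.
Let ip_ev := ds_ip_ev hS.
Let N_mono := ds_N_mono hS.
Implicit Types (f g h e : V) (c l : R[i]).

Lemma ev0 x : ev 0 x = 0.
Proof. by rewrite -(scale0r (0 : V)) evZ mul0r. Qed.

Lemma evN f x : ev (- f) x = - ev f x.
Proof. by rewrite -scaleN1r evZ mulN1r. Qed.

Definition mulX l g f := forall x, ev f x = ((X x)%:C - l) * ev g x.

Definition ran l f := exists g, mulX l g f.

Definition dec e l f c g := mulX l g (f - c *: e).

Let evE := (evD, evN, evZ, ev0).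

(** By injectivity of X at most one k has X k = l, and a vector vanishing off k is zero; at all
    other points X - l cancels. *)
Lemma mulX_inj l g g' f : mulX l g f -> mulX l g' f -> g = g'.
Proof.
move=> gf g'f; apply/eqP; rewrite -subr_eq0; apply/eqP.
have h x : (X x)%:C - l != 0 -> ev (g - g') x = 0.
  move=> xl; apply: (mulfI xl).
  by rewrite !evE mulrDr mulrN -gf -g'f subrr mulr0.
have [[k kl]|nk] := pselect (exists k, (X k)%:C = l).
  apply: (ev_eq0_off (k := k)) => x xk; apply: h; rewrite subr_eq0 -kl.
  by apply/eqP => /complexI/X_inj.
by apply: ev_eq0 => x; apply: h; rewrite subr_eq0; apply/eqP => xl; apply: nk; exists x.
Qed.

Lemma mulX0 l : mulX l 0 0.
Proof. by move=> x; rewrite !evE mulr0. Qed.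

Lemma mulXZ l c g f : mulX l g f -> mulX l (c *: g) (c *: f).
Proof. by move=> h x; rewrite !evE h mulrCA. Qed.

Lemma mulX_shift l l' g f : mulX l g f -> mulX l' g (f - (l' - l) *: g).
Proof. by move=> h x; rewrite !evE h; ring. Qed.

Lemma ranZ l c f : ran l f -> ran l (c *: f).
Proof. by move=> [g gf]; exists (c *: g); exact: mulXZ. Qed.

Lemma ranZK l c f : c != 0 -> ran l (c *: f) -> ran l f.
Proof. by move=> c0 /(ranZ c^-1); rewrite scalerA mulVf// scale1r. Qed.

Lemma dec_ran e l f c g : dec e l f c g -> ran l f -> c != 0 -> ran l e.
Proof.
move=> hd [u uf] c0; apply: (ranZK c0); exists (u - g) => x.
by have := hd x; rewrite !evE uf => h; rewrite mulrDr mulrN -h; ring.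
Qed.

Lemma dec_ran0 e l f g : dec e l f 0 g -> ran l f.
Proof. by rewrite /dec scale0r subr0 => h; exists g. Qed.

Lemma decD e l f c g f' c' g' : dec e l f c g -> dec e l f' c' g' ->
  dec e l (f + f') (c + c') (g + g').
Proof.
move=> h h' x; have := h x; have := h' x; rewrite !evE => hx hx'.
by rewrite mulrDr -hx -hx'; ring.
Qed.

Lemma decZ e l f c g b : dec e l f c g -> dec e l (b *: f) (b * c) (b *: g).
Proof. by move=> h x; have := h x; rewrite !evE mulrCA => <-; ring. Qed.

Lemma decB e l f c g f' c' g' : dec e l f c g -> dec e l f' c' g' ->
  dec e l (f - f') (c - c') (g - g').
Proof.
move=> h h' x; have := h x; have := h' x; rewrite !evE => hx hx'.
by rewrite mulrDr mulrN -hx -hx'; ring.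
Qed.

Lemma dec_unique e l f c g c' g' : ~ ran l e ->
  dec e l f c g -> dec e l f c' g' -> c = c' /\ g = g'.
Proof.
move=> ne h h'; have := decB h h'; rewrite subrr => hd.
have cc' : c = c'.
  apply/eqP; rewrite -subr_eq0; apply: contrapT => /negP c0; apply: ne.
  by apply: dec_ran hd _ c0; exists 0; exact: mulX0.
by split=> //; apply: mulX_inj h _; rewrite cc'.
Qed.

(* [X - l] is injective with closed range of codimension one, complementary
   to the line spanned by [e]. *)
Definition good e l (C1 C2 : R) := [/\ ~ ran l e, 0 <= C1, 0 <= C2 &
  forall f, exists c g, [/\ dec e l f c g, cabs c <= C1 * N f & N g <= C2 * N f]].

(* Neumann series: if [f = c f *: e + (X - l0) (B f)] and [h] solves
   [h - (l - l0) *: B h = f], then [f = c h *: e + (X - l) (B h)]. *)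
Lemma good_near e l0 l C1 C2 (q := cabs (l - l0) * C2) :
  good e l0 C1 C2 -> q < 1 -> good e l (C1 / (1 - q)) (C2 / (1 - q)).
Proof.
move=> [ne C10 C20 /choice[c0 /choice[B cB]]] q1.
have q0 : 0 <= q by rewrite mulr_ge0 ?cabs_ge0.
have hd f : dec e l0 f (c0 f) (B f) by have [] := cB f.
have hc f : cabs (c0 f) <= C1 * N f by have [] := cB f.
have hB f : N (B f) <= C2 * N f by have [] := cB f.
have BB f f' : B (f - f') = B f - B f'.
  by have [] := dec_unique ne (hd (f - f')) (decB (hd f) (hd f')).
pose s := l - l0.
have sB f : N (s *: B f) <= q * N f.
  by rewrite (N_scale hV) /q -mulrA ler_wpM2l ?cabs_ge0.
have p0 : 0 < 1 - q by rewrite subr_gt0.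
have Vp0 : 0 <= (1 - q)^-1 by rewrite invr_ge0 ltW.
split; [|by rewrite mulr_ge0|by rewrite mulr_ge0|].
  move=> [g eg]; apply: (ne); exists 0.
  (* From e = (X - l) g one gets s g = - e + (X - l0) g, so B (s g) = g by uniqueness; the
     contraction bound then forces g = 0. *)
  have eg0 : dec e l0 (s *: g) (-1) g.
    by move=> x; rewrite !evE eg /s; ring.
  have [_ Bg] := dec_unique ne (hd _) eg0.
  have g0 : g = 0.
    apply: (N_eq0 hV); apply/eqP; rewrite eq_le (N_ge0 hV) andbT.
    have : N g <= q * N g.
      by rewrite -{1}Bg (le_trans (hB _))// (N_scale hV) mulrA [C2 * _]mulrC.
    have := N_ge0 hV g; move: p0; nra.
  by move=> x; rewrite eg g0 ev0 !mulr0.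
move=> f; pose u := fix u n := if n is m.+1 then f + s *: B (u m) else 0.
have B0 : B 0 = 0 by rewrite -(subrr (0 : V)) BB !subrr.
have step n : N (u n.+1 - u n) <= N f * q ^+ n.
  elim: n => [|n IH]; first by rewrite /= B0 scaler0 addr0 subr0 mulr1.
  have -> : u n.+2 - u n.+1 = s *: B (u n.+1 - u n).
    by rewrite BB scalerBr /= opprD addrACA subrr add0r.
  by rewrite (le_trans (sB _))// exprS mulrCA ler_wpM2l.
have [h hu] := hilbert_complete hV q0 q1 step.
have hE : h = f + s *: B h.
  apply/eqP; rewrite -subr_eq0; apply/eqP.
  apply: (N_geometric_eq0 hV (M := N f / (1 - q) * 2) q0 q1) => n.
  have -> : h - (f + s *: B h) = (h - u n.+1) + s *: B (u n - h).
    by rewrite BB scalerBr /= !opprD !addrA subrK.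
  have h1 := hu n.+1; have h2 := le_trans (sB (u n - h)) (ler_wpM2l q0 _).
  have {h2} := h2 _ (eq_ind _ (fun y => y <= _) (hu n) _ (N_distC hV _ _)).
  have := N_triangle hV (h - u n.+1) (s *: B (u n - h)).
  move: h1; rewrite exprS.
  have : q * (N f * q ^+ n / (1 - q)) <= N f * q ^+ n / (1 - q).
    by rewrite ler_piMl ?mulr_ge0 ?(N_ge0 hV) ?exprn_ge0// ltW.
  rewrite [N f * (q * _) / _](_ : _ = q * (N f * q ^+ n / (1 - q))); last by ring.
  rewrite [_ * 2 * _](_ : _ = N f * q ^+ n / (1 - q) * 2); last by ring.
  lra.
have Nh : N h <= N f / (1 - q).
  rewrite ler_pdivlMr//.
  have := N_triangle hV f (s *: B h); rewrite -hE; have := sB h; lra.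
exists (c0 h), (B h); split.
- move=> x; have := hd h x; have : ev h x = ev (f + s *: B h) x by rewrite -hE.
  rewrite !evE /s => hx hdx; have {hx} -> : ev f x = ev h x - (l - l0) * ev (B h) x.
    by rewrite hx addrK.
  rewrite -addrA [- _ + _]addrC addrA hdx; ring.
- by rewrite (le_trans (hc h))// mulrAC -mulrA ler_wpM2l.
- by rewrite (le_trans (hB h))// mulrAC -mulrA ler_wpM2l.
Qed.

(** The constants no longer depend on l, as a second-order estimate on a whole disc requires. The +
    1 keeps the radius positive when C2 = 0, since the inverse of 0 is 0. *)
Lemma good_near_half e l0 l C1 C2 : good e l0 C1 C2 ->
  cabs (l - l0) < (2 * (C2 + 1))^-1 -> good e l (2 * C1) (2 * C2).
Proof.
move=> hg hl; have [_ C10 C20 _] := hg.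
have q2 : cabs (l - l0) * C2 <= 2^-1.
  move: hl; rewrite invfM ltr_pdivlMr ?ltr_wpDl// => hl.
  have := cabs_ge0 (l - l0); move: hl; lra.
have q1 : cabs (l - l0) * C2 < 1 by apply: le_lt_trans q2 _; rewrite invf_lt1// ltr1n.
have [ne _ _ hs] := good_near hg q1.
have hV2 : (1 - cabs (l - l0) * C2)^-1 <= 2.
  rewrite -[leRHS]invrK lef_pV2 ?posrE ?invr_gt0//; lra.
split; rewrite ?mulr_ge0// => f; have [c [g [hd hc hN]]] := hs f.
exists c, g; split=> //.
  rewrite (le_trans hc)// ler_wpM2r ?(N_ge0 hV)// mulrC ler_wpM2r//.
rewrite (le_trans hN)// ler_wpM2r ?(N_ge0 hV)// mulrC ler_wpM2r//.
Qed.

(** One Taylor step: X - l0 = (X - l) + (l - l0), so the quotient at l0 leaves the term (l - l0) g,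
    which is decomposed again at l. *)
Lemma dec_expand e l0 l f c g c1 g1 : ~ ran l e ->
  dec e l0 f c g -> dec e l g c1 g1 -> dec e l f (c + (l - l0) * c1) (g + (l - l0) *: g1).
Proof.
move=> ne h h1 x; have := h x; have := h1 x; rewrite !evE => hx1 hx.
have -> : ev f x = c * ev e x + ((X x)%:C - l0) * ev g x by rewrite -hx addrC subrK.
have -> : ((X x)%:C - l0) * ev g x = ((X x)%:C - l) * ev g x + (l - l0) * ev g x by ring.
have -> : (l - l0) * ev g x
    = (l - l0) * c1 * ev e x + ((X x)%:C - l) * ((l - l0) * ev g1 x).
  by rewrite [RHS]addrC mulrCA -hx1; ring.
by ring.
Qed.


(** Applying [dec_expand] twice gives F l = F l0 + (l - l0) c1 + (l - l0)^2 c2 with c2 bounded near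
    l0; the derivative is c1, the coefficient of the quotient of f at l0. *)
Lemma derivable_coef e l0 C1 C2 f (F : cplx R -> cplx R) : good e l0 C1 C2 ->
  (\forall l \near (l0 : cplx R), exists g, dec e l f (F l) g) ->
  derivable F l0 1.
Proof.
move=> hg hF; have [ne C10 C20 hs] := hg.
have [g0 hg0] : exists g, dec e l0 f (F l0) g := nbhs_singleton hF.
have [c1 [g1 [hg1 _ _]]] := hs g0.
move: hF => /cnbhsP[r r0 hF].
pose r' := Num.min r (2 * (C2 + 1))^-1.
apply: (@derivable_quadratic _ F l0 c1 (2 * C1 * N g1) r').
  by rewrite lt_min r0 invr_gt0 mulr_gt0// ltr_wpDl.
move=> l; rewrite lt_min => /andP[/hF[g hl] /(good_near_half hg)[nel _ _ hsl]].
have [c2 [g2 [hg2 hc2 _]]] := hsl g1.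
have [-> _] := dec_unique nel hl (dec_expand nel hg0 (dec_expand nel hg1 hg2)).
rewrite (_ : _ - _ = (l - l0) ^+ 2 * c2); last by ring.
by rewrite !cabsM [leRHS]mulrC ler_wpM2l// -?cabsM ?cabs_ge0// expr2.
Qed.

(** The range has codimension one, so every vector outside it spans a complement. For this reason
    [regular] can leave the vector e unspecified. *)
Lemma good_change e e' l C1 C2 : good e l C1 C2 -> ~ ran l e' ->
  exists C1' C2', good e' l C1' C2'.
Proof.
move=> [ne C10 C20 hs] ne'; have [c' [g' [hd' _ _]]] := hs e'.
have c'0 : c' != 0.
  by apply/eqP => c'0; apply: ne'; apply: (dec_ran0 (e := e) (g := g')); rewrite -c'0.
exists (C1 / cabs c'), (C2 + C1 / cabs c' * N g').
split=> //; rewrite ?addr_ge0 ?mulr_ge0 ?invr_ge0 ?cabs_ge0 ?(N_ge0 hV)// => f.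
have [c [g [hd hc hN]]] := hs f.
have hcc : cabs (c / c') <= C1 / cabs c' * N f.
  by rewrite cabsM cabsV mulrAC ler_wpM2r// invr_ge0 cabs_ge0.
exists (c / c'), (g - (c / c') *: g'); split=> //.
  move=> x; have := hd x; have := hd' x; rewrite !evE => h' h.
  have {h'} h' : ev e' x = c' * ev e x + ((X x)%:C - l) * ev g' x.
    by rewrite -h' addrC subrK.
  have {h} h : ev f x = c * ev e x + ((X x)%:C - l) * ev g x.
    by rewrite -h addrC subrK.
  by rewrite h h'; field.
rewrite (le_trans (N_triangle hV _ _))// (N_opp hV) (N_scale hV) mulrDl lerD//.
by rewrite mulrAC ler_wpM2r// (N_ge0 hV).
Qed.

(** * Boundedness of division at the points of T *)

Lemma kernel_exists k : exists K, forall f, ev f k = ip f K.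
Proof.
have [M MP] := ev_bounded k.
by apply: (@riesz _ _ _ _ hV (ev^~ k) _ _ M).
Qed.

Lemma kernel_neq0 k K : (forall f, ev f k = ip f K) -> K <> 0.
Proof. by move=> hK K0; have [f] := ev_sep k; rewrite hK K0 (ip0r hV) eqxx. Qed.

Lemma mulX_ip (t : R) u v f g : mulX t%:C u f -> mulX t%:C v g -> ip f v = ip u g.
Proof.
move=> uf vg; apply: ip_ev => x; rewrite uf vg -rmorphB conjcM conjc_real.
by rewrite -mulrA mulrCA.
Qed.

Lemma mulX_ev k g f : mulX (X k)%:C g f -> ev f k = 0.
Proof. by move=> ->; rewrite subrr mul0r. Qed.

Lemma N_gt0 f : f <> 0 -> 0 < N f.
Proof.
by move=> f0; rewrite lt_def (N_ge0 hV) andbT; apply/eqP => /(N_eq0 hV).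
Qed.

(* Hellinger-Toeplitz: the compression of division by [X - X k] to the
   orthogonal complement of the kernel at [k] is symmetric, hence bounded.
   The component along the kernel is recovered from the values at
   another point. *)
Lemma division_bounded k : exists2 C, 0 <= C &
  forall f g, mulX (X k)%:C g f -> N g <= C * N f.
Proof.
have [K hK] := kernel_exists k.
have K0 := kernel_neq0 hK.
have NK := N_gt0 K0.
set l := (X k)%:C.
pose c g := (N K ^- 2)%:C * ip g K.
pose P g := g - c g *: K.
have NKC : (N K ^- 2)%:C * (N K ^+ 2)%:C = 1 :> R[i].
  by rewrite -rmorphM mulVf ?rmorph1// expf_neq0// gt_eqF.
have PK g : ip (P g) K = 0.
  rewrite (ipBl hV) (ipZl hV) (ipff hV) /c mulrAC NKC mul1r subrr//.
have Psym f g : ip f (P g) = ip (P f) g.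
  rewrite (ipBl hV) (ipBr hV) (ipZl hV) (ipZr hV) /c conjcM conjc_real -(ipC hV).
  by rewrite [in LHS]mulrAC.
have [M hM] : exists M, forall w,
    [set P g | g in [set g | exists2 f, mulX l g f & N f <= 1]] w -> N w <= M.
  apply: (uniform_boundedness hV) => f.
  (* P f vanishes at k, so it is (X - l) u for some u. Symmetry then moves the division from h to P
     f: <f, P g> = <P f, g> = <u, h>, bounded by N u on the unit ball. *)
  have [u hu] : ran l (P f) by apply: ev_div; rewrite hK PK.
  exists (N u) => _ [g [h hg Nh] <-].
  rewrite Psym (mulX_ip hu hg) (le_trans (cauchy_schwarz hV _ _))//.
  by rewrite ler_piMr// (N_ge0 hV).
have {hM} hP f g : mulX l g f -> N (P g) <= `|M| * N f.
  move=> hg; apply: (@le_trans _ _ (M * N f)); last first.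
    by rewrite ler_wpM2r ?ler_norm ?(N_ge0 hV).
  have [f0|f0] := pselect (f = 0).
    have g0 : g = 0 by apply: mulX_inj hg _; rewrite f0; exact: mulX0.
    by rewrite g0 /P /c (ip0l hV) mulr0 scale0r subr0 f0 (N0 hV) mulr0.
  have Nf := N_gt0 f0.
  have := hM ((N f)^-1%:C *: P g); rewrite (N_scale hV) cabs_real.
  rewrite ger0_norm ?invr_ge0 ?(ltW Nf)//.
  rewrite -ler_pdivrMr// [N (P g) / _]mulrC; apply.
    exists ((N f)^-1%:C *: g).
      exists ((N f)^-1%:C *: f); first exact: mulXZ.
      by rewrite (N_scale hV) cabs_real ger0_norm ?invr_ge0 ?(ltW Nf)// mulVf ?gt_eqF.
    by rewrite /P /c (ipZl hV) scalerBr scalerA mulrCA.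
have [k' k'k Kk'] : exists2 k', k' <> k & ev K k' != 0.
  apply: contrapT => h; apply: K0; apply: (ev_eq0_off (k := k)) => x xk.
  by apply/eqP; apply: contrapT => /negP Kx; apply: h; exists x.
have [A hA] := ev_bounded k'.
have b0 : 0 < cabs (ev K k') by rewrite cabs_gt0.
have d0 : 0 < cabs ((X k')%:C - l).
  by rewrite cabs_gt0// subr_eq0; apply/eqP => /complexI/X_inj.
(* D bounds the value of (c g) K at k' relative to N f: the first term is for g, whose value there
   is that of f divided by X k' - X k, and the second for P g. *)
pose D := `|A| / cabs ((X k')%:C - l) + `|A| * `|M|.
exists (`|M| + D / cabs (ev K k') * N K) => [|f g hg].
  by rewrite !addr_ge0// !mulr_ge0 ?invr_ge0 ?addr_ge0 ?mulr_ge0 ?invr_ge0// ltW.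
have hA' h : cabs (ev h k') <= `|A| * N h.
  by rewrite (le_trans (hA h))// ler_wpM2r ?(N_ge0 hV)// ler_norm.
have hc : cabs (c g) <= D / cabs (ev K k') * N f.
  rewrite mulrAC ler_pdivlMr// -cabsM.
  have -> : c g * ev K k' = ev g k' - ev (P g) k' by rewrite /P !evE; ring.
  rewrite (le_trans (cabsD _ _))// cabsN /D mulrDl lerD//.
    rewrite mulrAC ler_pdivlMr//; have := hA' f.
    by rewrite hg cabsM mulrC.
  by rewrite (le_trans (hA' _))// -mulrA ler_wpM2l// hP.
have -> : g = P g + c g *: K by rewrite subrK.
rewrite (le_trans (N_triangle hV _ _))// mulrDl lerD//; first exact: hP.
by rewrite (N_scale hV) mulrAC ler_wpM2r ?(N_ge0 hV).
Qed.

Lemma good_point k e : ev e k != 0 -> exists C1 C2, good e (X k)%:C C1 C2.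
Proof.
move=> ek; have [C C0 hC] := division_bounded k; have [M hM] := ev_bounded k.
pose D := `|M| / cabs (ev e k).
have D0 : 0 <= D by rewrite mulr_ge0// invr_ge0 cabs_ge0.
exists D, (C * (1 + D * N e)).
split=> //; [|by rewrite mulr_ge0// addr_ge0// mulr_ge0// (N_ge0 hV)|].
  by move=> [g /mulX_ev] e0; rewrite e0 eqxx in ek.
move=> f; pose c := ev f k / ev e k.
have [g hg] : ran (X k)%:C (f - c *: e).
  by apply: ev_div; rewrite !evE divfK// subrr.
have hc : cabs c <= D * N f.
  rewrite cabsM cabsV mulrAC ler_wpM2r ?invr_ge0 ?cabs_ge0//.
  by rewrite (le_trans (hM f))// ler_wpM2r ?(N_ge0 hV)// ler_norm.
exists c, g; split=> //; rewrite (le_trans (hC _ _ hg))// -mulrA ler_wpM2l//.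
rewrite (le_trans (N_triangle hV _ _))// (N_opp hV) (N_scale hV) mulrDl mul1r lerD//.
by rewrite mulrAC ler_wpM2r// (N_ge0 hV).
Qed.

(* Choosing the complement orthogonal to the range makes the radius in
   [good_near] equal to the lower bound of [X - l]. *)
Lemma good_perp e l C1 C2 (d : R) : good e l C1 C2 -> 0 < d ->
  (forall f g, mulX l g f -> d * N g <= N f) ->
  exists e' C, good e' l C d^-1.
Proof.
move=> [ne C10 _ /choice[c /choice[g hcg]]] d0 hd.
have hdec f : dec e l f (c f) (g f) by have [] := hcg f.
(* The coefficient functional vanishes exactly on the range, so the vector representing it is
   orthogonal to the range. *)
have [e' he'] : exists e', forall f, c f = ip f e'.
  apply: (@riesz _ _ _ _ hV c _ _ C1) => [f h|b f|f]; last by have [] := hcg f.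
    by have [] := dec_unique ne (hdec (f + h)) (decD (hdec f) (hdec h)).
  by have [] := dec_unique ne (hdec (b *: f)) (decZ b (hdec f)).
have e'0 : e' <> 0.
  move=> e'0; apply: ne; apply: (dec_ran0 (e := e) (g := g e)).
  by have := hdec e; rewrite {1}he' e'0 (ip0r hV).
have Ne' := N_gt0 e'0.
exists e', (N e')^-1; split; rewrite ?invr_ge0 ?(ltW Ne') ?(ltW d0)//.
  move=> [u hu]; apply: e'0; apply: (N_eq0 hV).
  have hu' : dec e l e' 0 u by move=> x; rewrite scale0r subr0 hu.
  have [+ _] := dec_unique ne (hdec e') hu'.
  rewrite he' (ipff hV) => /(@complexI R _ 0)/eqP.
  by rewrite sqrf_eq0 => /eqP.
move=> f; pose b := (N e' ^- 2)%:C * ip f e'.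
have f1 : c (f - b *: e') = 0.
  rewrite he' (ipBl hV) (ipZl hV) (ipff hV) /b mulrAC -rmorphM mulVf.
    by rewrite rmorph1 mul1r subrr.
  by rewrite expf_neq0// gt_eqF.
have hgf : mulX l (g (f - b *: e')) (f - b *: e').
  by have := hdec (f - b *: e'); rewrite f1 /dec scale0r subr0.
exists b, (g (f - b *: e')); split=> //.
  rewrite cabsM cabs_real ger0_norm ?invr_ge0 ?sqr_ge0//.
  have := cauchy_schwarz hV f e'; rewrite -ler_pdivrMr// => h.
  rewrite mulrC [leRHS]mulrC expr2 invfM mulrA ler_wpM2r// invr_ge0 ltW//.
rewrite mulrC ler_pdivlMr// mulrC (le_trans (hd _ _ hgf))//.
rewrite -(ler_pXn2r (n := 2)) ?nnegrE ?(N_ge0 hV)//.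
have hf : f = (f - b *: e') + b *: e' by rewrite subrK.
rewrite [in leRHS]hf [leRHS](sqr_ND hV) (ipZr hV) -he' f1 mulr0 mulr0 addr0.
by rewrite lerDl sqr_ge0.
Qed.

(** * Regular points and the spreading of regularity *)

Definition regular l := exists e C1 C2, good e l C1 C2.

Lemma mulX_lower l (d : R) : 0 <= d -> (forall x, d <= cabs ((X x)%:C - l)) ->
  forall f g, mulX l g f -> d * N g <= N f.
Proof.
move=> d0 hd f g hg; apply: N_mono => // x.
by rewrite hg cabsM ler_wpM2r// cabs_ge0.
Qed.

Lemma regular_near l0 l (d : R) : regular l0 ->
  (forall x, d <= cabs ((X x)%:C - l0)) -> cabs (l - l0) < d -> regular l.
Proof.
move=> [e [C1 [C2 he]]] hd hl.
have d0 : 0 < d := le_lt_trans (cabs_ge0 _) hl.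
have [e' [C he']] := good_perp he d0 (mulX_lower (ltW d0) hd).
exists e', (C / (1 - cabs (l - l0) * d^-1)), (d^-1 / (1 - cabs (l - l0) * d^-1)).
by apply: good_near => //; rewrite ltr_pdivrMr// mul1r.
Qed.

(* At [X p + i v] the lower bound of [X - l] is [|v|], so regularity spreads
   from [X p] up the vertical line and then over the whole half-plane. *)
Lemma regular_nonreal (p : T) l : complex.Im l != 0 -> regular l.
Proof.
move=> l0; have [e ep] := ev_sep p.
have [C1 [C2 hp]] := good_point ep.
have C20 : 0 <= C2 by case: hp.
pose s : R := Num.sg (complex.Im l).
have s1 : `|s| = 1 by rewrite /s normr_sg l0.
pose P v := regular ((X p) +i* (s * v)).
have Plow v x : 0 <= v -> v <= cabs ((X x)%:C - ((X p) +i* (s * v))).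
  move=> v0; apply: le_trans (Im_le_cabs _).
  by rewrite /= sub0r normrN normrM s1 mul1r ger0_norm.
(* Half the radius of [good_near_half], for a strict inequality. *)
pose eps := (2 * (2 * (C2 + 1)))^-1.
have eps0 : 0 < eps by rewrite invr_gt0 !mulr_gt0// ltr_wpDl.
have cabs_vert (a b c : R) : cabs ((a +i* b) - (a +i* c)) = `|b - c|.
  by rewrite /cabs /= subrr expr0n /= add0r sqrtr_sqr.
have Peps : P eps.
  exists e, (2 * C1), (2 * C2); apply: (good_near_half hp).
  rewrite cabs_vert subr0 normrM s1 mul1r ger0_norm ?ltW//.
  by rewrite /eps invfM gtr_pMl ?invr_gt0 ?mulr_gt0 ?ltr_wpDl// invf_lt1// ltr1n.
(* The lower bound at height v is v itself, and v is at least eps, so a step of eps / 2 stays inside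
   the disc. *)
have Pn n : P (eps + n%:R * (eps / 2)).
  elim: n => [|n IH]; first by rewrite mul0r addr0.
  have n0 : 0 <= n%:R * (eps / 2) by rewrite mulr_ge0// divr_ge0// ltW.
  have v0 : 0 <= eps + n%:R * (eps / 2) by rewrite addr_ge0// ltW.
  apply: (regular_near IH (fun x => Plow _ x v0)).
  rewrite cabs_vert -mulrBr normrM s1 mul1r.
  have -> : eps + n.+1%:R * (eps / 2) - (eps + n%:R * (eps / 2)) = eps / 2.
    by rewrite -natr1; ring.
  by rewrite gtr0_norm ?divr_gt0//; lra.
pose u := complex.Re l - X p; pose w := `|complex.Im l|.
have w0 : 0 < w by rewrite normr_gt0.
(* The disc of radius v about X p + i s v contains l as soon as u ^+ 2 + (w - v) ^+ 2 < v ^+ 2, that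
   is, (u ^+ 2 + w ^+ 2) / (2 w) < v. *)
pose n := (Num.truncn ((u ^+ 2 + w ^+ 2) / (2 * w) / (eps / 2))).+1.
have hn : (u ^+ 2 + w ^+ 2) / (2 * w) < n%:R * (eps / 2).
  by rewrite -ltr_pdivrMr ?divr_gt0// truncnS_gt.
set v := eps + n%:R * (eps / 2).
have nv : n%:R * (eps / 2) < v by rewrite ltrDr.
have v0 : 0 < v by rewrite addr_gt0// mulr_gt0// divr_gt0.
apply: (regular_near (Pn n) (fun x => Plow _ x (ltW v0))).
rewrite -(ltr_pXn2r (n := 2)) ?nnegrE ?cabs_ge0 ?(ltW v0)//.
have -> : cabs (l - (X p +i* (s * v))) ^+ 2 = u ^+ 2 + (w - v) ^+ 2.
  have lE : l = complex.Re l +i* (s * w).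
    by rewrite /s /w -numEsg; case: (l).
  rewrite sqr_cabs {1 2}lE /= -/u -/v -mulrBr exprMn -(real_normK (num_real s)) s1.
  by rewrite expr1n mul1r.
move: hn; rewrite ltr_pdivrMr ?mulr_gt0// => hn.
have : u ^+ 2 + w ^+ 2 < v * (2 * w) by apply: lt_trans hn _; rewrite ltr_pM2r ?mulr_gt0.
lra.
Qed.

(** The non-real point t + i d / 2 is regular, lies at distance d / 2 from t, and has distance at
    least d from every X x. *)
Lemma regular_outside (p : T) (t d : R) : 0 < d -> (forall x, d <= `|X x - t|) ->
  regular t%:C.
Proof.
move=> d0 hd; apply: (@regular_near (t +i* (d / 2)) _ d).
- by apply: (regular_nonreal p); rewrite /= gt_eqF// divr_gt0.
- by move=> x; rewrite (le_trans (hd x))// (le_trans _ (Re_le_cabs _)).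
- rewrite /cabs /= subrr expr0n /= add0r sqrtr_sqr sub0r normrN.
  by rewrite gtr0_norm ?divr_gt0//; lra.
Qed.

Lemma regular_point k : regular (X k)%:C.
Proof. by have [e /good_point[C1 [C2 he]]] := ev_sep k; exists e, C1, C2. Qed.

(** * The kernel at p and the quotients by it *)

Section Kernel.
Context (p : T) (K : V).
Hypothesis hK : forall f, ev f p = ip f K.

Let K0 : K <> 0 := kernel_neq0 hK.

Let mulXp_ip g h : mulX (X p)%:C g h -> ip h K = 0.
Proof. by move=> /mulX_ev; rewrite hK. Qed.

Let mulXp_eq0 g h : mulX (X p)%:C g h -> N h = 0 -> g = 0.
Proof.
by move=> hg /(N_eq0 hV) h0; apply: mulX_inj hg _; rewrite h0; exact: mulX0.
Qed.

Let mulX_eq0 l g : mulX l g K -> g <> 0.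
Proof. by move=> hg g0; apply: K0; apply: ev_eq0 => x; rewrite hg g0 ev0 mulr0. Qed.

(** Put h = (X - X p) g and s = X p - l, so that K = h + s g. Since h vanishes at p, 0 = <h, K> = N
    h ^+ 2 + conj(s) <h, g>, where <h, g> is real by symmetry. If s were not real, this would give
    <h, g> = 0, then h = 0, g = 0 and K = 0. *)
Lemma kernel_ran_real l : ran l K -> complex.Im l = 0.
Proof.
move=> [g hg]; apply/eqP; apply: contrapT => /negP l0.
have := mulX_shift (X p)%:C hg; set s := _ - l; set h := K - _ => hh.
have KE : K = h + s *: g by rewrite subrK.
have hgr : complex.Im (ip h g) = 0.
  have : ip h g = ip g h.
    by apply: ip_ev => x; rewrite !hh conjcM -rmorphB conjc_real mulrCA mulrA.
  rewrite [ip g h](ipC hV); case: (ip h g) => a b [] /eqP /=.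
  by rewrite -subr_eq0 opprK -mulr2n mulrn_eq0 /= => /eqP.
apply: (mulX_eq0 hg); apply: (mulXp_eq0 hh).
have := mulXp_ip hh; rewrite KE (ipDr hV) (ipZr hV) (ipff hV).
have sI : complex.Im s != 0.
  by rewrite /s; case: (l) l0 => a b /= b0; rewrite sub0r oppr_eq0.
move: sI hgr; case: (s) => s1 s2; case: (ip h g) => m1 m2 /= s20 -> [].
rewrite !mulr0 oppr0 addr0 !add0r => h1 /eqP.
rewrite mulf_eq0 oppr_eq0 (negPf s20)/= => /eqP m0.
by move: h1; rewrite m0 mulr0 addr0 => /eqP; rewrite sqrf_eq0 => /eqP.
Qed.

(* This is why the poles of [f / K] are simple. *)
Lemma kernel_ran_simple (t : R) g : mulX t%:C g K -> ~ ran t%:C g.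
Proof.
move=> hg [g2 hg2].
have hh := mulX_shift (X p)%:C hg; have hh2 := mulX_shift (X p)%:C hg2.
set s := _ - t%:C in hh hh2; set h := K - _ in hh; set h2 := g - _ in hh2.
(* Here h = (X - X p) g and h2 = (X - X p) g2, so h = (X - t) h2 and <h, g> = <h2, K> by symmetry;
   this is 0 because h2 vanishes at p. *)
have hE : mulX t%:C h2 h by move=> x; rewrite hh hh2 hg2; ring.
have hg0 : ip h g = 0 by rewrite (mulX_ip hE hg) (mulXp_ip hh2).
apply: (mulX_eq0 hg); apply: (mulXp_eq0 hh).
have := mulXp_ip hh; have -> : K = h + s *: g by rewrite subrK.
rewrite (ipDr hV) (ipZr hV) (ipff hV) hg0 mulr0 addr0 => /(@complexI R _ 0)/eqP.
by rewrite sqrf_eq0 => /eqP.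
Qed.

Lemma regular_kernel_quotient l g : regular l -> mulX l g K ->
  exists C1 C2, good g l C1 C2.
Proof.
move=> [e [C1 [C2 he]]] hg; apply: good_change he _.
have lR : l = (complex.Re l)%:C.
  have := kernel_ran_real (ex_intro _ g hg); case: (l) => a b /= ->//.
by move: hg; rewrite lR; exact: kernel_ran_simple.
Qed.

Lemma regular_kernel l : regular l -> ~ ran l K -> exists C1 C2, good K l C1 C2.
Proof. by move=> [e [C1 [C2 he]]]; exact: good_change he. Qed.

Lemma good_near_nbhs e l C1 C2 : good e l C1 C2 ->
  \forall z \near (l : cplx R), good e z (2 * C1) (2 * C2).
Proof.
move=> he; have [_ _ C20 _] := he.
apply/cnbhsP; exists (2 * (C2 + 1))^-1; first by rewrite invr_gt0 mulr_gt0// ltr_wpDl.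
by move=> z; exact: good_near_half.
Qed.

(* Near a point where [K = (X - l) g], the kernel is [(z - l) g + (X - z) g];
   so the coefficient of [f] along [K] is that along [g] divided by [z - l]. *)
Lemma kernel_dec l z g : mulX l g K -> dec g z K (z - l) g.
Proof. exact: mulX_shift. Qed.

Lemma nran_kernel l z g : mulX l g K -> ~ ran z g -> z != l -> ~ ran z K.
Proof.
move=> hg ng zl hz; apply: ng; apply: dec_ran (kernel_dec z hg) hz _.
by rewrite subr_eq0.
Qed.

(* The value at [z] of the extension of [f / K]; the second alternative fills
   in the removable singularities. *)
Definition quotient_value f z c :=
  (~ ran z K /\ exists w, dec K z f c w) \/
  (exists g u w, [/\ mulX z g K, mulX z u f & dec g z u c w]).

Definition kernel_quotient f (z : cplx R) : cplx R := xget 0 (quotient_value f z).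

Lemma kernel_quotientE f z c w : ~ ran z K -> dec K z f c w -> kernel_quotient f z = c.
Proof.
move=> nK hc; rewrite /kernel_quotient.
case: xgetP => [c' _ [[_ [w' hc']]|[g [u [w' [hg _ _]]]]]|/(_ c)].
- by have [] := dec_unique nK hc' hc.
- by case: nK; exists g.
- by case; left; split=> //; exists w.
Qed.

Lemma kernel_quotientE_removable f z g u c w : ~ ran z g ->
  mulX z g K -> mulX z u f -> dec g z u c w -> kernel_quotient f z = c.
Proof.
move=> ng hg hu hc; rewrite /kernel_quotient.
case: xgetP => [c' _ [[nK _]|[g' [u' [w' [hg' hu' hc']]]]]|/(_ c)].
- by case: nK; exists g.
- move: hc'; rewrite (mulX_inj hg' hg) (mulX_inj hu' hu) => hc'.
  by have [] := dec_unique ng hc' hc.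
- by case; right; exists g, u, w.
Qed.

Lemma kernel_quotient_point f x : ev K x != 0 ->
  kernel_quotient f (X x)%:C = ev f x / ev K x.
Proof.
move=> Kx; have [w hw] : ran (X x)%:C (f - (ev f x / ev K x) *: K).
  by apply: ev_div; rewrite !evE divfK// subrr.
by apply: kernel_quotientE hw => -[g /mulX_ev Kx0]; rewrite Kx0 eqxx in Kx.
Qed.

Lemma kernel_quotient_derivable f l C1 C2 : good K l C1 C2 ->
  derivable (kernel_quotient f) l 1.
Proof.
move=> hl; apply: derivable_coef (hl) _.
apply: filterS (good_near_nbhs hl) => z [nz _ _ /(_ f)[c [w [hc _ _]]]].
by exists w; rewrite (kernel_quotientE nz hc).
Qed.

Lemma kernel_quotient_analytic f l : regular l -> ~ ran l K ->
  analytic_at (kernel_quotient f) l.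
Proof.
move=> rl nl; have [C1 [C2 hl]] := regular_kernel rl nl.
apply: filterS (good_near_nbhs hl) => z; exact: kernel_quotient_derivable.
Qed.

(** If K = (X - l) g, then g is a complement near l and excludes K from the range off l; otherwise K
    is itself a complement near l. Zeros of K and possible poles are isolated by this one fact. *)
Lemma nran_kernel_dnbhs l : regular l -> \forall z \near (l : cplx R)^', ~ ran z K.
Proof.
move=> rl; have [[g hg]|nl] := pselect (ran l K).
  have [C1 [C2 /good_near_nbhs/cnbhsP[r r0 hr]]] := regular_kernel_quotient rl hg.
  apply/cdnbhsP; exists r => // z zl /hr[ng _ _ _].
  exact: nran_kernel hg ng zl.
have [C1 [C2 /good_near_nbhs/cnbhsP[r r0 hr]]] := regular_kernel rl nl.
by apply/cdnbhsP; exists r => // z zl /hr[].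
Qed.

(** Three cases. If K is not in the range, the quotient is analytic. If K = (X - l) g and f = (X -
    l) u, it is the coefficient of u along g, so the singularity is removable. If only K is in the
    range, the coefficient of f along g is nonzero at l, and dividing it by z - l gives a pole. *)
Lemma kernel_quotient_meromorphic f l : regular l ->
  analytic_at (kernel_quotient f) l \/ is_pole (kernel_quotient f) l.
Proof.
move=> rl; have [[g hg]|nl] := pselect (ran l K); last first.
  by left; exact: kernel_quotient_analytic.
have [C1 [C2 hl]] := regular_kernel_quotient rl hg.
have [nl C10 C20 _] := hl.
have [[u hu]|nf] := pselect (ran l f).
  left; have hF : \forall z \near (l : cplx R),
      exists w, dec g z u (kernel_quotient f z) w.
    apply: filterS (good_near_nbhs hl) => z [nz _ _ /(_ u)[c [w [hc _ _]]]].
    exists w; rewrite (_ : kernel_quotient f z = c)//.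
    have [zl|zl] := eqVneq z l.
      by move: nz hc; rewrite zl => nz hc; exact: kernel_quotientE_removable hc.
    (* Here f - c K = (X - l) (u - c g) with u - c g = (X - z) w; writing X - l = (X - z) + (z - l)
       exhibits the factor X - z. *)
    apply: (kernel_quotientE (w := (z - l) *: w + u - c *: g)).
      exact: nran_kernel hg nz zl.
    move=> x; have := hc x; rewrite !evE hu hg => h.
    have -> : ev u x = c * ev g x + ((X x)%:C - z) * ev w x by rewrite -h addrC subrK.
    by ring.
  have hF' := nbhs_interior hF.
  have hG := good_near_nbhs hl.
  apply: filterS (filterI hF' hG) => z [hz gz].
  exact: derivable_coef gz hz.
right; split.
  have [r r0 hr] := (cnbhsP _ _).1 (good_near_nbhs hl).
  apply/cdnbhsP; exists r => // z zl /hr hz.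
  have [ng _ _ _] := hz.
  have [C1' [C2' hz']] := good_change hz (nran_kernel hg ng zl).
  exact: kernel_quotient_derivable hz'.
have [_ _ _ /(_ f)[c0 [g0 [hc0 _ _]]]] := hl.
have c00 : c0 != 0.
  by apply/eqP => c00; apply: nf; apply: (dec_ran0 (e := g) (g := g0)); rewrite -c00.
have [r r0 hr] := (cnbhsP _ _).1 (good_near_nbhs hl).
apply/cvgryPge => A.
(* From c (z - l) = c0 + (z - l) c1 and |c1| <= 2 C1 N g0, the inequality |z - l| B < |c0| yields
   |c| > |A|. *)
set B := 2 * C1 * N g0 + `|A|.
have B0 : 0 <= B by rewrite addr_ge0// mulr_ge0 ?(N_ge0 hV)// mulr_ge0.
apply/cdnbhsP; exists (Num.min r (cabs c0 / (B + 1))).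
  by rewrite lt_min r0 divr_gt0 ?cabs_gt0// ltr_wpDl.
move=> z zl; rewrite lt_min ltr_pdivlMr ?ltr_wpDl// => /andP[/hr[ng _ _ hs] hzB].
have [c1 [g1 [hc1 hc1N _]]] := hs g0.
have hd := dec_expand ng hc0 hc1.
have [c [w hw]] : exists c w, dec K z f c w.
  exists ((c0 + (z - l) * c1) / (z - l)).
  exists ((g0 + (z - l) *: g1) - ((c0 + (z - l) * c1) / (z - l)) *: g) => x.
  have := hd x; rewrite !evE hg => h.
  have -> : ev f x = (c0 + (z - l) * c1) * ev g x
      + ((X x)%:C - z) * (ev g0 x + (z - l) * ev g1 x) by rewrite -h addrC subrK.
  by field; rewrite subr_eq0.
have nz := nran_kernel hg ng zl.
rewrite (kernel_quotientE nz hw).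
have cE : c * (z - l) = c0 + (z - l) * c1.
  have hw' : dec g z f (c * (z - l)) (w + c *: g).
    move=> x; have := hw x; rewrite !evE hg => h; rewrite [RHS]mulrDr -h; ring.
  by have [] := dec_unique ng hw' hd.
have z0 : 0 < cabs (z - l) by rewrite cabs_gt0// subr_eq0.
have := cabsD (c * (z - l)) (- ((z - l) * c1)).
rewrite {1}cE addrK cabsN !cabsM => h.
have {}hzB : cabs (z - l) * B < cabs c0.
  by apply: le_lt_trans hzB; rewrite ler_wpM2l ?cabs_ge0// lerDl.
have : cabs (z - l) * B < cabs (z - l) * (cabs c + cabs c1) by lra.
rewrite ltr_pM2l// /B; have := ler_norm A; lra.
Qed.

Lemma kernel_quotient_pole f l : regular l -> is_pole (kernel_quotient f) l -> ran l K.
Proof.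
move=> rl [_ hp]; apply: contrapT => nl.
have [M hM] := derivable_bounded_near (nbhs_singleton (kernel_quotient_analytic f rl nl)).
have /cvgryPgt/(_ M) hp' := hp.
have : \forall z \near (l : cplx R)^', False.
  have hM' : \forall z \near (l : cplx R)^', cabs (kernel_quotient f z) <= M.
    exact: nbhs_dnbhs hM.
  apply: filterS (filterI hp' hM') => z [h1 h2].
  by have := lt_le_trans h1 h2; rewrite ltxx.
by move=> /filter_ex[].
Qed.

End Kernel.

End Division.

(** * The function space as a vector space type *)

Section SubspaceType.
Context {R : realType} {U : set R} {H : set (U -> R[i])}.

(* The argument [lin] lets unification find the proof that [H] is a subspace. *)
Definition in_subspace of linear_set H : pred (U -> R[i]^o) := fun f => `[< H f >].

Fact in_subspace_closed (lin : linear_set H) : submod_closed (in_subspace lin).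
Proof.
have [h0 hD hZ] := lin; split; first exact/asboolP.
by move=> c f g /asboolP Hf /asboolP Hg; apply/asboolP/hD => //; exact: hZ.
Qed.

HB.instance Definition _ lin := GRing.isSubmodClosed.Build R[i] (U -> R[i]^o)
  (in_subspace lin) (in_subspace_closed lin).

Definition subspace_type lin := {f | in_subspace lin f}.

HB.instance Definition _ lin := SubChoice.copy (subspace_type lin) {f | in_subspace lin f}.
HB.instance Definition _ lin := [SubChoice_isSubLmodule of subspace_type lin by <:].

End SubspaceType.

(** * Extension by zero and Borel measurability *)

Section ZeroExtension.
Context {R : realType} {U : set R}.
Implicit Types f g : U -> R[i].

Lemma zext_val f (x : U) : zext f (val x) = f x.
Proof. by have := valLK 0 f; rewrite -set_valE => /(congr1 (@^~ x)). Qed.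

Lemma zext_in f x : U x -> exists u : U, val u = x /\ zext f x = f u.
Proof. by move=> Ux; exists (exist _ x (mem_set Ux)); rewrite -zext_val. Qed.

Lemma zextD f g x : zext (fun y => f y + g y) x = zext f x + zext g x.
Proof. by rewrite /zext /valL_ /=; case: ('oinv_ _ x) => [y|] /=; rewrite ?addr0. Qed.

Lemma zextB f g x : zext (fun y => f y - g y) x = zext f x - zext g x.
Proof. by rewrite /zext /valL_ /=; case: ('oinv_ _ x) => [y|] /=; rewrite ?subr0. Qed.

Lemma zextZ c f x : zext (fun y => c * f y) x = c * zext f x.
Proof. by rewrite /zext /valL_ /=; case: ('oinv_ _ x) => [y|] /=; rewrite ?mulr0. Qed.

End ZeroExtension.

Section Borel.
Context {R : realType} {U : set R}.
Hypothesis mU : measurable (U : set (measurableTypeR R)).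
Implicit Types f g : U -> R[i].
Notation bC := (g_sigma_algebraType (@open (cplx R))).
Notation mR := (measurableTypeR R).

Lemma measurable_Re_borel : measurable_fun [set: bC] (fun z : bC => complex.Re (z : R[i])).
Proof.
move=> mD; apply: (measurability _ (RGenOInfty.measurableE R)) => //.
move=> _ [_ [a ->] <-]; rewrite setTI; apply: sub_sigma_algebra.
rewrite openE => z /=; rewrite in_itv /= andbT => az.
apply/cnbhsP; exists (complex.Re z - a); first by rewrite subr_gt0.
move=> w hw; rewrite /= in_itv /= andbT.
have := le_lt_trans (Re_le_cabs _) hw; case: (w) (z) => a1 b1 [a2 b2] /=.
by rewrite ltr_norml => /andP[]; lra.
Qed.

Lemma measurable_Im_borel : measurable_fun [set: bC] (fun z : bC => complex.Im (z : R[i])).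
Proof.
move=> mD; apply: (measurability _ (RGenOInfty.measurableE R)) => //.
move=> _ [_ [a ->] <-]; rewrite setTI; apply: sub_sigma_algebra.
rewrite openE => z /=; rewrite in_itv /= andbT => az.
apply/cnbhsP; exists (complex.Im z - a); first by rewrite subr_gt0.
move=> w hw; rewrite /= in_itv /= andbT.
have := le_lt_trans (Im_le_cabs _) hw; case: (w) (z) => a1 b1 [a2 b2] /=.
by rewrite ltr_norml => /andP[]; lra.
Qed.

Lemma measurable_Re_zext f : borelC f ->
  measurable_fun (U : set mR) (fun x => complex.Re (zext f x)).
Proof. exact: (measurableT_comp measurable_Re_borel). Qed.

Lemma measurable_Im_zext f : borelC f ->
  measurable_fun (U : set mR) (fun x => complex.Im (zext f x)).
Proof. exact: (measurableT_comp measurable_Im_borel). Qed.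

Lemma measurable_sqr_cabs (h : R -> R[i]) :
  measurable_fun (U : set mR) (fun x => complex.Re (h x)) ->
  measurable_fun (U : set mR) (fun x => complex.Im (h x)) ->
  measurable_fun (U : set mR) (fun x => (cabs (h x) ^+ 2)%:E).
Proof.
move=> mRe mIm; apply/measurable_EFinP.
under eq_fun do rewrite sqr_cabs.
by apply: measurable_funD; exact: measurable_funX.
Qed.

Lemma measurable_sqr_cabs_borel f : borelC f ->
  measurable_fun (U : set mR) (fun x => (cabs (zext f x) ^+ 2)%:E).
Proof.
move=> bf; apply: measurable_sqr_cabs.
  exact: measurable_Re_zext.
exact: measurable_Im_zext.
Qed.

Lemma measurable_sqr_cabsB f g : borelC f -> borelC g ->
  measurable_fun (U : set mR) (fun x => (cabs (zext (fun y => f y - g y) x) ^+ 2)%:E).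
Proof.
move=> bf bg; apply: measurable_sqr_cabs.
  rewrite (_ : (fun _ => _) = (fun x => complex.Re (zext f x))
      \- (fun x => complex.Re (zext g x))).
    by apply: measurable_funB; exact: measurable_Re_zext.
  by apply/funext => x /=; rewrite zextB; case: (zext f x) (zext g x) => ? ? [].
rewrite (_ : (fun _ => _) = (fun x => complex.Im (zext f x))
    \- (fun x => complex.Im (zext g x))).
  by apply: measurable_funB; exact: measurable_Im_zext.
by apply/funext => x /=; rewrite zextB; case: (zext f x) (zext g x) => ? ? [].
Qed.

Lemma borelC_lim (u : nat -> U -> R[i]) f : (forall n, borelC (u n)) ->
  (forall (x : U) (e : R), 0 < e -> exists n0, forall n, (n0 <= n)%N ->
     cabs (u n x - f x) < e) ->
  borelC f.
Proof.
move=> bu uf; apply: (@measurability _ _ mR bC _ _ (@open (cplx R))) => // _ [G oG <-].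
pose e m : R := m.+1%:R^-1.
have e0 m : 0 < e m by rewrite invr_gt0.
(* f x lies in G exactly when, for some m, the terms u n x eventually lie in [S m]. The doubled
   radius lets membership pass to the limit: f x is within e m of u n x, itself within e m of w. *)
pose S m : set bC := [set z | exists2 w : cplx R,
  forall y, cabs (y - w) < 2 * e m -> G y & cabs (z - w) < e m].
have mS m : measurable (S m).
  apply: sub_sigma_algebra; rewrite openE => z [w hw hz].
  apply/cnbhsP; exists (e m - cabs (z - w)); first by rewrite subr_gt0.
  move=> y hy; exists w => //; have := cabsD (y - z) (z - w).
  by rewrite addrA subrK; lra.
rewrite (_ : _ `&` _ = \bigcup_m \bigcup_n0 \bigcap_(n in [set n | (n0 <= n)%N])
    ((U : set mR) `&` zext (u n) @^-1` S m)).
  apply: bigcupT_measurable => m; apply: bigcupT_measurable => n0.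
  apply: bigcap_measurable => [|n _]; first by exists n0 => /=.
  exact: bu.
apply/seteqP; split => x /=.
  move=> [Ux Gx]; have [y [xy fxy]] := zext_in f Ux.
  have /cnbhsP[r r0 hr] : nbhs (zext f x : cplx R) G by move: oG; rewrite openE; exact.
  have [m hm] : exists m, 2 * e m < r.
    exists (Num.truncn (2 / r)); rewrite ltr_pdivrMr// mulrC -ltr_pdivrMr//.
    exact: truncnS_gt.
  have [n0 hn0] := uf y _ (e0 m).
  exists m => //; exists n0 => // n /= n0n; split=> //.
  exists (zext f x); first by move=> z hz; apply: hr; exact: lt_trans hm.
  by rewrite fxy -xy zext_val; exact: hn0.
move=> [m _ [n0 _ hn]]; have [Ux _] := hn n0 (leqnn _).
split=> //; have [y [xy fxy]] := zext_in f Ux.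
have [n1 hn1] := uf y _ (e0 m).
have [_ [w hw hwu]] := hn (maxn n0 n1) (leq_maxl _ _).
apply: hw; rewrite fxy; have := hn1 _ (leq_maxr n0 n1).
move: hwu; rewrite -xy zext_val.
have := cabsD (f y - u (maxn n0 n1) y) (u (maxn n0 n1) y - w).
by rewrite addrA subrK [cabs (f y - _)]cabsB; lra.
Qed.

End Borel.

(** * Square-integrable functions: inner product, norm and Fatou's lemma *)

Section L2Facts.
Context {R : realType} {mu : {measure set (measurableTypeR R) -> \bar R}} {U : set R}.
Hypothesis mU : measurable (U : set (measurableTypeR R)).
Implicit Types f g h : U -> R[i].
Notation mR := (measurableTypeR R).

Lemma sqint_ge0 f : (0 <= sqint mu f)%E.
Proof. by apply: integral_ge0 => x _; rewrite lee_fin sqr_ge0. Qed.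

Lemma L2norm_ge0 f : 0 <= L2norm mu f.
Proof. exact: sqrtr_ge0. Qed.

Lemma sqint_L2 f : L2 mu f -> sqint mu f = (L2norm mu f ^+ 2)%:E.
Proof.
move=> [_ foo]; rewrite /L2norm sqr_sqrtr ?fine_ge0 ?sqint_ge0//.
by rewrite fineK// ge0_fin_numE// sqint_ge0.
Qed.

Lemma L2norm_le f (r : R) : 0 <= r -> (sqint mu f <= (r ^+ 2)%:E)%E -> L2norm mu f <= r.
Proof.
move=> r0 hf; rewrite -(ger0_norm r0) -sqrtr_sqr ler_wsqrtr//.
by rewrite -lee_fin fineK// ge0_fin_numE ?sqint_ge0// (le_lt_trans hf)// ltry.
Qed.

Lemma L2_integrable_sqr f : L2 mu f ->
  mu.-integrable U (EFin \o (fun x => cabs (zext f x) ^+ 2)).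
Proof.
move=> [bf foo]; apply/integrableP; split; first exact: measurable_sqr_cabs_borel.
by under eq_integral do rewrite gee0_abs ?lee_fin ?sqr_ge0//.
Qed.

Let re_prod f g x := complex.Re (zext f x) * complex.Re (zext g x)
  + complex.Im (zext f x) * complex.Im (zext g x).
Let im_prod f g x := complex.Im (zext f x) * complex.Re (zext g x)
  - complex.Re (zext f x) * complex.Im (zext g x).

Let L2innerE f g : L2inner mu f g =
  (\int[mu]_(x in U) re_prod f g x) +i* (\int[mu]_(x in U) im_prod f g x).
Proof.
rewrite /L2inner /Cintegral; congr (_ +i* _); apply: eq_Rintegral => x _;
  rewrite conjCE /re_prod /im_prod; case: (zext f x) (zext g x) => a b [c d] /=; ring.
Qed.

Let prod_bound (F : R -> R) f g : L2 mu f -> L2 mu g ->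
  measurable_fun (U : set mR) F ->
  (forall x, `|F x| <= cabs (zext f x * (zext g x)^*%C)) ->
  mu.-integrable U (EFin \o F).
Proof.
move=> f2 g2 mF hF.
pose sq (h : U -> R[i]) x := cabs (zext h x) ^+ 2.
apply: (le_integrable mU (f := EFin \o F)
    (g := ((EFin \o sq f) \+ (EFin \o sq g))%E)) => [|x _|].
- exact/measurable_EFinP.
- rewrite [leRHS](_ : _ = `|sq f x + sq g x|%:E)// lee_fin.
  rewrite (le_trans (hF x))// /sq ger0_norm.
    by rewrite cabsM cabsJ; have := sqr_ge0 (cabs (zext f x) - cabs (zext g x));
      have := sqr_ge0 (cabs (zext f x) + cabs (zext g x)); lra.
  by rewrite addr_ge0// sqr_ge0.
- by apply: integrableD => //; exact: L2_integrable_sqr.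
Qed.

Let re_integrable f g : L2 mu f -> L2 mu g -> mu.-integrable U (EFin \o re_prod f g).
Proof.
move=> f2 g2; have [[bf _] [bg _]] := (f2, g2); apply: prod_bound f2 g2 _ _.
  apply: measurable_funD; apply: measurable_funM;
    by [exact: measurable_Re_zext | exact: measurable_Im_zext].
move=> x; apply: le_trans (Re_le_cabs _); rewrite /re_prod.
by case: (zext f x) (zext g x) => a b [c d] /=; rewrite mulrN opprK.
Qed.

Let im_integrable f g : L2 mu f -> L2 mu g -> mu.-integrable U (EFin \o im_prod f g).
Proof.
move=> f2 g2; have [[bf _] [bg _]] := (f2, g2); apply: prod_bound f2 g2 _ _.
  apply: measurable_funB; apply: measurable_funM;
    by [exact: measurable_Re_zext | exact: measurable_Im_zext].
move=> x; apply: le_trans (Im_le_cabs _); rewrite /im_prod.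
by case: (zext f x) (zext g x) => a b [c d] /=; rewrite mulrN addrC.
Qed.

Lemma L2innerDl f f' g : L2 mu f -> L2 mu f' -> L2 mu g ->
  L2inner mu (fun x => f x + f' x) g = L2inner mu f g + L2inner mu f' g.
Proof.
move=> f2 f'2 g2; rewrite !L2innerE.
have -> : re_prod (fun x => f x + f' x) g = (fun x => re_prod f g x + re_prod f' g x).
  apply/funext => x; rewrite /re_prod zextD.
  by case: (zext f x) (zext f' x) => a b [c d] /=; ring.
have -> : im_prod (fun x => f x + f' x) g = (fun x => im_prod f g x + im_prod f' g x).
  apply/funext => x; rewrite /im_prod zextD.
  by case: (zext f x) (zext f' x) => a b [c d] /=; ring.
have h1 := re_integrable f2 g2; have h2 := re_integrable f'2 g2.
have h3 := im_integrable f2 g2; have h4 := im_integrable f'2 g2.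
by rewrite (RintegralD mU h1 h2) (RintegralD mU h3 h4).
Qed.

Lemma L2innerZl c f g : L2 mu f -> L2 mu g ->
  L2inner mu (fun x => c * f x) g = c * L2inner mu f g.
Proof.
move=> f2 g2; rewrite !L2innerE.
set c1 := complex.Re c; set c2 := complex.Im c.
have hre := re_integrable f2 g2; have him := im_integrable f2 g2.
have hZ (d : R) (F : R -> R) : mu.-integrable U (EFin \o F) ->
    mu.-integrable U (EFin \o (fun x => d * F x)).
  move=> hF; have := integrableZl mU d hF.
  by apply: eq_integrable => // x _; rewrite /= EFinM.
have -> : re_prod (fun x => c * f x) g
    = (fun x => c1 * re_prod f g x - c2 * im_prod f g x).
  apply/funext => x; rewrite /re_prod /im_prod zextZ.
  by rewrite /c1 /c2; case: (c) (zext f x) => a1 b1 [a b] /=; ring.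
have -> : im_prod (fun x => c * f x) g
    = (fun x => c1 * im_prod f g x + c2 * re_prod f g x).
  apply/funext => x; rewrite /re_prod /im_prod zextZ.
  by rewrite /c1 /c2; case: (c) (zext f x) => a1 b1 [a b] /=; ring.
rewrite (RintegralB mU (hZ c1 _ hre) (hZ c2 _ him)).
rewrite (RintegralD mU (hZ c1 _ him) (hZ c2 _ hre)).
rewrite (RintegralZl c1 mU hre) (RintegralZl c2 mU him).
rewrite (RintegralZl c1 mU him) (RintegralZl c2 mU hre).
by rewrite /c1 /c2; case: (c).
Qed.

Lemma L2inner_conj f g : L2 mu f -> L2 mu g ->
  L2inner mu g f = (L2inner mu f g)^*%C.
Proof.
move=> f2 g2; rewrite !L2innerE /=; congr (_ +i* _).
  by apply: eq_Rintegral => x _; rewrite /re_prod; ring.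
rewrite -mulN1r -RintegralZl//; last exact: im_integrable.
by apply: eq_Rintegral => x _; rewrite /im_prod; ring.
Qed.

Lemma L2inner_norm f : L2 mu f -> L2inner mu f f = (L2norm mu f ^+ 2)%:C.
Proof.
move=> f2; rewrite L2innerE; congr (_ +i* _).
  have -> : re_prod f f = (fun x => cabs (zext f x) ^+ 2).
    by apply/funext => x; rewrite /re_prod sqr_cabs; ring.
  by rewrite /L2norm sqr_sqrtr// fine_ge0// sqint_ge0.
have -> : im_prod f f = (fun=> 0) by apply/funext => x; rewrite /im_prod; ring.
by rewrite /Rintegral integral0.
Qed.

Lemma L2norm_null k f : mu [set val k] = 0%E -> L2 mu f ->
  (forall x, x <> k -> f x = 0) -> L2norm mu f = 0.
Proof.
move=> k0 [bf _] fk; rewrite /L2norm.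
have -> : sqint mu f = 0%E; last by rewrite sqrtr0.
rewrite /sqint -(integral0 mu U); apply: ae_eq_integral => //.
  exact: measurable_sqr_cabs_borel.
exists [set val k]; split; [exact: measurable_set1 | exact: k0 |].
move=> x /= /not_implyP[Ux]; have [y [<- ->]] := zext_in f Ux.
apply: contra_notP => yk; rewrite fk ?cabs0 ?expr0n// => ky; apply: yk.
by rewrite ky.
Qed.

Lemma L2norm_le_abs f g : L2 mu f -> L2 mu g ->
  (forall x, cabs (f x) <= cabs (g x)) -> L2norm mu f <= L2norm mu g.
Proof.
move=> [bf _] g2 fg; apply: L2norm_le; first exact: L2norm_ge0.
rewrite -sqint_L2//; apply: ge0_le_integral => //.
- by move=> x _; rewrite lee_fin sqr_ge0.
- exact: measurable_sqr_cabs_borel.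
- by case: g2 => bg _; exact: measurable_sqr_cabs_borel.
move=> x Ux; rewrite lee_fin; have [y [<- ->]] := zext_in f Ux.
by rewrite zext_val ler_pXn2r ?nnegrE ?cabs_ge0.
Qed.

(** Fatou's lemma with a function h subtracted: h = 0 will show that the limit is square-integrable,
    and h = u n will give the rate of convergence. *)
Lemma sqint_fatou (u : nat -> U -> R[i]) f h (B : R) n0 :
  (forall n, borelC (u n)) -> borelC h ->
  (forall (x : U) (e : R), 0 < e -> exists n0, forall n, (n0 <= n)%N ->
     cabs (u n x - f x) < e) ->
  (forall n, (n0 <= n)%N -> (sqint mu (fun x => (u n x - h x)%R) <= B%:E)%E) ->
  (sqint mu (fun x => (f x - h x)%R) <= B%:E)%E.
Proof.
move=> bu bh uf hB.
pose F n x := (cabs (zext (fun y => u (n0 + n)%N y - h y) x) ^+ 2)%:E.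
have -> : sqint mu (fun x => f x - h x) = (\int[mu]_(x in U) limn_einf (F^~ x))%E.
  apply: eq_integral => x /set_mem Ux; apply/esym.
  have [y [_ fxy]] := zext_in (fun y => f y - h y) Ux.
  have [y' [xy' _]] := zext_in h Ux.
  have hF : F^~ x @ \oo --> (cabs (zext (fun y => f y - h y) x) ^+ 2)%:E.
    apply/fine_cvgP; split; first by exists 0%N.
    rewrite (_ : fine \o _ = (fun n => cabs (zext (fun y => u (n0 + n)%N y - h y) x) ^+ 2))//.
    have hC : (fun n => cabs (zext (fun y => u (n0 + n)%N y - h y) x)) @ \oo -->
        cabs (zext (fun y => f y - h y) x).
      apply/cvgrPdist_lt => e e0.
      have [n1 hn1] := uf y' e e0; exists n1 => // n /= n1n.
      rewrite -xy' !zext_val; apply: le_lt_trans (hn1 (n0 + n)%N (leq_trans n1n (leq_addl _ _))).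
      have h1 := cabsD (f y' - u (n0 + n)%N y') (u (n0 + n)%N y' - h y').
      have h2 := cabsD (u (n0 + n)%N y' - f y') (f y' - h y').
      rewrite !addrA !subrK in h1 h2; rewrite [cabs (f y' - u _ _)]cabsB in h1.
      by rewrite ler_norml; apply/andP; split; lra.
    exact: (cvgM hC hC).
  by have [-> _] := cvg_limn_einf_sup hF.
apply: (le_trans (fatou mu mU _ _)).
- by move=> n; exact: measurable_sqr_cabsB.
- by move=> n x _; rewrite lee_fin sqr_ge0.
rewrite limn_einf_lim; apply: lime_le; first exact: is_cvg_einfs.
exists 0%N => // n _; apply: ereal_inf_le.
exists (\int[mu]_(x in U) F n x)%E; first by exists n => /=.
exact: hB (leq_addr _ _).
Qed.

End L2Facts.

(** * Completeness of the reproducing kernel subspace *)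

Section Completeness.
Context {R : realType} {mu : {measure set (measurableTypeR R) -> \bar R}} {U : set R}.
Hypothesis mU : measurable (U : set (measurableTypeR R)).
Context {H : set (U -> R[i])}.
Hypothesis hH : repr_kernel_subspace mu H.

Let lin : linear_set H := let: And4 l _ _ _ := hH in l.
Let HL2 : H `<=` @L2 _ mu U := let: And4 _ l _ _ := hH in l.
Let Hclosed : L2closed mu H := let: And4 _ _ c _ := hH in c.
Let Hev : forall k, bounded_evaluation mu H k := let: And4 _ _ _ b := hH in b.

Definition sub_val (f : subspace_type lin) : U -> R[i] := val f.
Definition sub_ip (f g : subspace_type lin) := L2inner mu (sub_val f) (sub_val g).
Definition sub_norm (f : subspace_type lin) := L2norm mu (sub_val f).

Lemma sub_valP f : H (sub_val f).
Proof. exact: (asboolW (valP f)). Qed.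

Lemma sub_valZ c f x : sub_val (c *: f) x = c * sub_val f x.
Proof. by []. Qed.

Lemma sub_val_eq0 f : (forall x, sub_val f x = 0) -> f = 0.
Proof. by move=> f0; apply/val_inj/funext => x; exact: f0. Qed.

Lemma sub_norm_ev x : exists M : R, forall f, cabs (sub_val f x) <= M * sub_norm f.
Proof. by have [M hM] := Hev x; exists M => f; apply: hM; exact: sub_valP. Qed.

Let sub_L2 f : L2 mu (sub_val f). Proof. exact/HL2/sub_valP. Qed.

(** Bounded evaluations make a function of norm zero vanish at every point, so H needs no passage to
    classes. *)
Lemma sub_norm_eq0 f : sub_norm f = 0 -> f = 0.
Proof.
move=> f0; apply: sub_val_eq0 => x; have [M /(_ f)] := sub_norm_ev x.
rewrite f0 mulr0 => h; apply/cabs_eq0/eqP; rewrite eq_le h; exact: cabs_ge0.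
Qed.

Lemma sub_prehilbert : prehilbert sub_ip sub_norm.
Proof.
split.
- by move=> f g h; exact: (L2innerDl mU (sub_L2 f) (sub_L2 g) (sub_L2 h)).
- by move=> c f g; exact: (L2innerZl mU c (sub_L2 f) (sub_L2 g)).
- by move=> f g; exact: L2inner_conj.
- by move=> f; exact: L2inner_norm.
- by move=> f; exact: L2norm_ge0.
- exact: sub_norm_eq0.
Qed.

Let geometric_small (B q e : R) : 0 <= q -> q < 1 -> 0 < e ->
  exists n0, forall n, (n0 <= n)%N -> B * q ^+ n < e.
Proof.
move=> q0 q1 e0.
have : (fun n => B * q ^+ n) @ \oo --> (B * 0 : R).
  by apply: cvgM; [exact: cvg_cst | apply: cvg_expr; rewrite ger0_norm].
rewrite mulr0 => /cvgrPdist_lt/(_ e e0) [n0 _ hn0]; exists n0 => n /hn0 /=.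
by rewrite sub0r normrN; apply: le_lt_trans; exact: ler_norm.
Qed.

Let real_geometric_cvg (a : nat -> R) (B q : R) : 0 <= q -> q < 1 ->
  (forall n m, (n <= m)%N -> `|a m - a n| <= B * q ^+ n) ->
  exists l, forall n, `|a n - l| <= B * q ^+ n.
Proof.
move=> q0 q1 ha.
have : cvgn a.
  apply/cauchy_cvgP/cauchy_exP => e e0.
  have [n0 hn0] := geometric_small B q0 q1 e0.
  exists (a n0); exists n0 => // n /= n0n; rewrite /ball/= distrC.
  exact: le_lt_trans (ha _ _ n0n) (hn0 _ (leqnn _)).
move=> /cvg_ex[l al]; exists l => n; apply/ler_addgt0Pr => e e0.
have [m _ hm] := (cvgrPdist_lt _ _).1 al e e0.
have := hm (maxn n m) (leq_maxr _ _) => /= h.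
have h2 := ha _ _ (leq_maxl n m).
have := ler_normD (a n - a (maxn n m)) (a (maxn n m) - l); rewrite addrA subrK.
by rewrite distrC in h2; rewrite distrC in h; lra.
Qed.

(** Bounded evaluations give a pointwise limit f, and Fatou's lemma the rate in norm. Closedness
    yields only a g in H equal to f almost everywhere; that g is the limit, and the norms do not see
    the difference. *)
Lemma sub_complete (u : nat -> subspace_type lin) (M q : R) : 0 <= q -> q < 1 ->
  (forall n, sub_norm (u n.+1 - u n) <= M * q ^+ n) ->
  exists l, forall n, sub_norm (l - u n) <= M * q ^+ n / (1 - q).
Proof.
move=> q0 q1 hu.
have hc := N_geometric_cauchy sub_prehilbert q0 q1 hu.
have p0 : 0 < 1 - q by rewrite subr_gt0.
have M0 : 0 <= M by have := hu 0%N; rewrite mulr1; apply: le_trans; exact: L2norm_ge0.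
have hcx x : exists B, forall n m, (n <= m)%N ->
    cabs (sub_val (u m) x - sub_val (u n) x) <= B * q ^+ n.
  have [A hA] := sub_norm_ev x; exists (`|A| * (M / (1 - q))) => n m nm.
  apply: (le_trans (hA (u m - u n))).
  apply: (@le_trans _ _ (`|A| * sub_norm (u m - u n))).
    by rewrite ler_wpM2r ?ler_norm// L2norm_ge0.
  by rewrite -mulrA ler_wpM2l// mulrAC hc.
have : forall x, exists z : R[i], forall e : R, 0 < e -> exists n0, forall n, (n0 <= n)%N ->
    cabs (sub_val (u n) x - z) < e.
  move=> x; have [B hB] := hcx x.
  have hRe n m : (n <= m)%N ->
      `|complex.Re (sub_val (u m) x) - complex.Re (sub_val (u n) x)| <= B * q ^+ n.
    move=> nm; apply: le_trans (hB n m nm); apply: le_trans (Re_le_cabs _).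
    by case: (sub_val (u m) x) (sub_val (u n) x) => ? ? [].
  have hIm n m : (n <= m)%N ->
      `|complex.Im (sub_val (u m) x) - complex.Im (sub_val (u n) x)| <= B * q ^+ n.
    move=> nm; apply: le_trans (hB n m nm); apply: le_trans (Im_le_cabs _).
    by case: (sub_val (u m) x) (sub_val (u n) x) => ? ? [].
  have [a ha] := real_geometric_cvg q0 q1 hRe.
  have [b hb] := real_geometric_cvg q0 q1 hIm.
  exists (a +i* b) => e e0.
  have [n0 hn0] := geometric_small B q0 q1 (divr_gt0 e0 (ltr0n _ 2)).
  exists n0 => n /hn0; have := ha n; have := hb n.
  move: (sub_val (u n) x) => [c d] /= hbd hac hn.
  have := cabs_le_ReIm ((c +i* d) - (a +i* b)) => /=; lra.
move=> /choice[f uf].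
have bu n : borelC (sub_val (u n)) by case: (sub_L2 (u n)).
have bf : borelC f by exact: borelC_lim uf.
pose r n := M * q ^+ n / (1 - q).
have r0 n : 0 <= r n by rewrite divr_ge0 ?(ltW p0)// mulr_ge0 ?exprn_ge0.
have hfu n : (sqint mu (fun x => (f x - sub_val (u n) x)%R) <= (r n ^+ 2)%:E)%E.
  apply: (sqint_fatou mU (n0 := n) bu (bu n) uf) => m nm.
  have -> : sqint mu (fun x => (sub_val (u m) x - sub_val (u n) x)%R)
      = sqint mu (sub_val (u m - u n)) by [].
  rewrite sqint_L2// lee_fin ler_pXn2r ?nnegrE ?L2norm_ge0//.
  exact: hc.
have f2 : L2 mu f.
  split=> //.
  have : (sqint mu (fun x => (f x - sub_val 0 x)%R) <= ((r 0 + sub_norm (u 0))%R ^+ 2)%:E)%E.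
    apply: (sqint_fatou mU (n0 := 0%N) bu _ uf) => [|m _]; first by case: (sub_L2 0).
    have -> : sqint mu (fun x => (sub_val (u m) x - sub_val 0 x)%R)
        = sqint mu (sub_val (u m - 0)) by [].
    rewrite subr0 sqint_L2// lee_fin ler_pXn2r ?nnegrE ?addr_ge0 ?L2norm_ge0//.
    have := N_triangle sub_prehilbert (u m - u 0%N) (u 0%N); rewrite subrK.
    by move=> h; apply: le_trans h _; rewrite lerD2r; exact: hc.
  rewrite (_ : (fun x => f x - sub_val 0 x) = f); last first.
    by apply/funext => x; rewrite [sub_val 0 x](_ : _ = 0)// subr0.
  by move=> h; apply: le_lt_trans h _; rewrite ltry.
have [g Hg fg] : exists2 g, H g & ae_eq mu U (zext f) (zext g).
  apply: Hclosed => // e e0.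
  have [n0 hn0] := geometric_small (M / (1 - q)) q0 q1 e0.
  exists (sub_val (u n0)); first exact: sub_valP.
  apply: le_lt_trans (L2norm_le (r0 n0) (hfu n0)) _.
  by rewrite /r mulrAC; exact: hn0.
have Hg' : in_subspace lin g by exact/asboolP.
exists (exist _ g Hg' : subspace_type lin) => n.
apply: (L2norm_le (r0 n)); apply: le_trans (hfu n).
rewrite le_eqVlt; apply/orP; left; apply/eqP.
have [bg _] := HL2 Hg.
apply: ae_eq_integral => //; try exact: measurable_sqr_cabsB.
apply: filterS fg => x /= fgx Ux.
by rewrite !zextB fgx.
Qed.

Lemma sub_hilbert : hilbert sub_ip sub_norm.
Proof. split; [exact: sub_prehilbert | exact: sub_complete]. Qed.

End Completeness.

(** * The subspace as a division space, and regularity off the boundary *)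

Lemma limit_point_cdnbhs {R : realType} (A : set R) (x : R) (P : set (cplx R)) :
  limit_point A x -> (\forall z \near (x%:C : cplx R)^', P z) ->
  exists2 y, A y & P y%:C.
Proof.
move=> Ax /cdnbhsP[r r0 hr].
have [y [yx Ay xy]] := Ax _ (nbhsx_ballx x r r0).
exists y => //; apply: hr; first by apply: contra yx => /eqP/complexI ->.
by rewrite -rmorphB cabs_real distrC.
Qed.

Lemma outside_closure {R : realType} (U : set R) (t : R) : ~ closure U t ->
  exists2 d : R, 0 < d & forall x, U x -> d <= `|x - t|.
Proof.
move=> Ut; apply: contrapT => h; apply: Ut => B /nbhs_ballP[/= e e0 eB].
apply: contrapT => UB; apply: h; exists e => // x Ux; rewrite leNgt; apply/negP => xt.
by apply: UB; exists x; split=> //; apply: eB; rewrite /ball/= distrC.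
Qed.

Section SubDivision.
Context {R : realType} {mu : {measure set (measurableTypeR R) -> \bar R}} {U : set R}.
Hypothesis mu_no_atoms : forall x : R, mu [set x] = 0%E.
Hypothesis mU : measurable (U : set (measurableTypeR R)).
Context {H : set (U -> R[i])}.
Hypothesis hH : repr_kernel_subspace mu H.
Hypothesis H_sep : separates_zeros H.
Hypothesis H_div : forall (k : U) (f : U -> R[i]), H f -> f k = 0 -> quotient_in H f k.

Definition sub_of f (Hf : H f) : subspace_type (let: And4 l _ _ _ := hH in l) :=
  exist _ f (asboolT Hf).

Lemma L2inner_eq (f g f' g' : U -> R[i]) :
  (forall x, f x * (g x)^*%C = f' x * (g' x)^*%C) ->
  L2inner mu f g = L2inner mu f' g'.
Proof.
move=> h; rewrite /L2inner; congr Cintegral; apply/funext => x.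
rewrite !conjCE /zext /valL_ /=; case: ('oinv_ _ x) => [y|] /=; first exact: h.
by rewrite !mul0r.
Qed.

Lemma sub_division_space :
  division_space (sub_ip (hH := hH)) (sub_norm (hH := hH)) \val (sub_val (hH := hH)).
Proof.
have hV := sub_hilbert mU hH.
have HL : H `<=` @L2 _ mu U by case: hH.
have HL2 f : L2 mu (sub_val (hH := hH) f) by apply/HL/sub_valP.
split=> //.
- exact: sub_val_eq0.
- move=> k f fk; apply: (N_eq0 hV); apply: (L2norm_null mU _ (HL2 f) fk).
  exact: mu_no_atoms.
- exact: sub_norm_ev.
- by move=> x; have [f Hf fx] := H_sep x; exists (sub_of Hf).
- move=> k f /(H_div (sub_valP f))[h Hh hf]; exists (sub_of Hh) => x.
  by rewrite -(hf x) rmorphB mulrC.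
- by move=> f g f' g'; exact: L2inner_eq.
- move=> d f g d0 fg; have := N_scale hV d%:C f; rewrite cabs_real ger0_norm// => <-.
  apply: (L2norm_le_abs mU (HL2 _) (HL2 _)) => x.
  by rewrite sub_valZ cabsM cabs_real ger0_norm.
Qed.

(** A point off the boundary is non-real, or interior to U and hence a value of X, or at positive
    distance from U. *)
Lemma sub_regular (p : U) (a : cplx R) : (~` realset (boundary U)) a ->
  regular (sub_norm (hH := hH)) \val (sub_val (hH := hH)) a.
Proof.
move=> Ga; have [a0|a0] := eqVneq (complex.Im a) 0; last first.
  exact: (regular_nonreal sub_division_space p).
have aE : a = (complex.Re a)%:C by case: (a) a0 => x y /= ->.
move: Ga; rewrite aE; set t := complex.Re a => Gt.
have nb : ~ boundary U t by move=> Ut; apply: Gt; exists t.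
have [Ut|/outside_closure[d d0 hd]] := pselect (closure U t).
  have /interior_subset/(zext_in (fun=> 0))[y [<- _]] : interior U t.
    by apply: contrapT => nU; apply: nb.
  exact: (regular_point sub_division_space).
apply: (regular_outside sub_division_space p d0) => x.
exact/hd/set_valP.
Qed.

End SubDivision.

Theorem theorem3p5 (R : realType)
    (mu : {measure set (measurableTypeR R) -> \bar R})
    (mu_sigma_finite : sigma_finite [set: measurableTypeR R] mu)
    (mu_no_atoms : forall x : R, mu [set x] = 0%E)
    (U : set R) (U_borel : measurable (U : set (measurableTypeR R)))
    (mu_off_U : mu (~` U) = 0%E)
    (H : set (U -> R[i]))
    (H_rks : repr_kernel_subspace mu H)
    (H_sep : separates_zeros H)
    (H_div : forall (k : U) (f : U -> R[i]),
        H f -> f k = 0 -> quotient_in H f k)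
    (p : U) :
  [/\ limit_point (zeros (repr_kernel mu H p)) `<=` boundary U,
      exists V : set (cplx R),
        [/\ open V, V (val p)%:C &
            forall f, H f -> exists F : cplx R -> cplx R,
              analytic_on V F /\
              extends_quotient f (repr_kernel mu H p) V F] &
      exists N : set R,
        [/\ N `<=` ~` boundary U,
            limit_point N `&` ~` boundary U = set0 &
            forall f, H f -> exists F : cplx R -> cplx R,
              let G := ~` realset (boundary U) in
              [/\ meromorphic_on G F,
                  poles_in G F `<=` realset N &
                  extends_quotient f (repr_kernel mu H p)
                    (G `\` poles_in G F) F]]].
Proof.
have hS := sub_division_space mu_no_atoms U_borel H_rks H_sep H_div.
have reg := sub_regular mu_no_atoms U_borel H_rks H_sep H_div p.
have [HK HKp] : is_repr_kernel mu H p (repr_kernel mu H p).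
  have [K hK] := kernel_exists hS p.
  apply: (@xgetPex _ _ [set K | is_repr_kernel mu H p K]).
  exists (sub_val K); split; first exact: sub_valP.
  by move=> f Hf; exact: (hK (sub_of H_rks Hf)).
pose K := sub_of H_rks HK.
have hK f : sub_val f p = sub_ip f K by apply: HKp; exact: sub_valP.
pose ranK (z : R[i]) := ran \val (sub_val (hH := H_rks)) z K.
have realG t : ~ boundary U t -> (~` realset (boundary U)) t%:C.
  by move=> Ut [s Us /complexI st]; apply: Ut; rewrite -st.
have limK A t : A `<=` [set t | ranK t%:C] -> limit_point A t -> boundary U t.
  move=> AK At; apply: contrapT => /realG/reg rt.
  by have [y /AK] := limit_point_cdnbhs At (nran_kernel_dnbhs hS hK rt).
split.
(* A zero of K in U puts K in the range there, by divisibility. *)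
- move=> t; apply: limK => _ [u <- Ku]; exact: (ds_ev_div hS).
(* The points where K itself is a complement: an open set independent of f, containing p because
   K(p) is the squared norm of K. *)
- exists [set z | exists C1 C2,
    good (sub_norm (hH := H_rks)) \val (sub_val (hH := H_rks)) K z C1 C2].
  split.
  + rewrite openE => z [C1 [C2 hz]].
    by apply: filterS (good_near_nbhs hS hz) => w hw; exists (2 * C1), (2 * C2).
  + apply: (good_point hS); apply/eqP => Kp0.
    apply: (kernel_neq0 hS hK); apply: (N_eq0 (ds_hilbert hS)).
    have := ipff (ds_hilbert hS) K; rewrite -hK Kp0 => /(@complexI R 0)/esym/eqP.
    by rewrite sqrf_eq0 => /eqP.
  + move=> f Hf; exists (kernel_quotient \val (sub_val (hH := H_rks)) K (sub_of H_rks Hf)).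
    split=> [z [C1 [C2 hz]]|x Kx _]; first exact: (kernel_quotient_derivable hS hz).
    exact: (kernel_quotient_point hS (K := K) (sub_of H_rks Hf) Kx).
(* All real points off the boundary where K lies in the range. This set is independent of f, and a
   given quotient may be regular at some of its points. *)
- exists [set t | ~ boundary U t /\ ranK t%:C]; split; first by move=> t [].
    by apply/seteqP; split=> // t [Nt]; apply; apply: limK Nt => s [].
  move=> f Hf; exists (kernel_quotient \val (sub_val (hH := H_rks)) K (sub_of H_rks Hf)).
  move=> G; split.
  + by move=> a /reg ra; exact: (kernel_quotient_meromorphic hS hK).
  + move=> a [Ga pa]; have Ka := kernel_quotient_pole hS (reg _ Ga) pa.
    have aE : a = (complex.Re a)%:C.
      by have := kernel_ran_real hS hK Ka; case: (a) => x y /= ->.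
    exists (complex.Re a); last by rewrite -aE.
    split; last by rewrite -aE.
    by move=> Ua; apply: Ga; exists (complex.Re a).
  + move=> x Kx _; exact: (kernel_quotient_point hS (K := K) (sub_of H_rks Hf) Kx).
Qed.
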